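(* Let $\mathcal{C}$ be a finite tensor category over an algebraically closed field $k$, let $\{V_0,\dots,V_m\}$ be a complete set of representatives of isomorphism classes of simple objects of $\mathcal{C}$, and let $P_i$ be the projective cover of $V_i$. Then for every $k$-linear left exact functor $F:\mathcal{C}\to\mathcal{C}$, $$\left[\int^{X\in\mathcal{C}}{}^*X\boxtimes F(X)\right]=\sum_{i,j=0}^m[F(P_i^* ):V_j]\cdot[V_i\boxtimes V_j]$$ in the Grothendieck group $\mathsf{Gr}(\mathcal{C}\boxtimes\mathcal{C})$, where $[X:V_j]$ denotes the multiplicity of $V_j$ in a composition series of $X$.
   Context: A finite tensor category over $k$ is a rigid monoidal category that is, as a $k$-linear category, equivalent to the category of finite-dimensional modules over a finite-dimensional $k$-algebra, with $\otimes$ $k$-linear in each variable and $\mathrm{End}(\mathbf{1})\cong k$. $X^*$ denotes the left dual (with evaluation $X^*\otimes X\to\mathbf{1}$ and coevaluation $\mathbf{1}\to X\otimes X^*$) and ${}^*X$ the right dual, with $({}^*X)^*=X={}^*(X^* )$. $\boxtimes$ is the Deligne tensor product of $k$-linear abelian categories. The coend $\int^{X\in\mathcal{C}}{}^*X\boxtimes F(X)$ in $\mathcal{C}\boxtimes\mathcal{C}$ exists for every $k$-linear left exact $F:\mathcal{C}\to\mathcal{C}$; it is known that $F\mapsto\int^{X\in\mathcal{C}}{}^*X\boxtimes F(X)$ is a quasi-inverse of the equivalence from $\mathcal{C}\boxtimes\mathcal{C}$ to the category of $k$-linear left exact endofunctors of $\mathcal{C}$ given by $X\boxtimes Y\mapsto\mathrm{Hom}_{\mathcal{C}}(X^*,-)\cdot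 Y$ (where $K\cdot Y$ for a finite-dimensional vector space $K$ is the copower, $\mathrm{Hom}_{\mathcal{C}}(K\cdot Y,W)\cong\mathrm{Hom}_k(K,\mathrm{Hom}_{\mathcal{C}}(Y,W))$). *)

(* Defs.v *)
From HB Require Import structures.
From mathcomp Require Import all_boot all_order all_algebra all_field.
From mathcomp Require Import boolp classical_sets.

Set Implicit Arguments.
Unset Strict Implicit.
Unset Printing Implicit Defensive.
Import GRing.Theory.
Local Open Scope ring_scope.

(** * Linear categories *)

Record lincat (k : fieldType) := LinCat {
  ob :> Type;
  mor : ob -> ob -> lmodType k;
  idm : forall X, mor X X;
  mcomp : forall X Y Z, mor Y Z -> mor X Y -> mor X Z;
  comp1m : forall X Y (f : mor X Y), mcomp (idm Y) f = f;
  compm1 : forall X Y (f : mor X Y), mcomp f (idm X) = f;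
  compA : forall X Y Z W (h : mor Z W) (g : mor Y Z) (f : mor X Y),
    mcomp h (mcomp g f) = mcomp (mcomp h g) f;
  comp_linl : forall X Y Z (f : mor X Y), linear (fun g : mor Y Z => mcomp g f);
  comp_linr : forall X Y Z (g : mor Y Z), linear (fun f : mor X Y => mcomp g f)
}.

Arguments mor {k C} X Y : rename.
Arguments idm {k C} X : rename.
Arguments mcomp {k C X Y Z} g f : rename.

Notation "g \oc f" := (mcomp g f) (at level 40, left associativity).

Section InACategory.
Context {k : fieldType} {C : lincat k}.
Implicit Types X Y Z W : C.

Definition is_iso X Y (f : mor X Y) :=
  exists g : mor Y X, g \oc f = idm X /\ f \oc g = idm Y.

Definition iso X Y := exists f : mor X Y, is_iso f.

Definition is_mono X Y (f : mor X Y) :=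
  forall W (g h : mor W X), f \oc g = f \oc h -> g = h.

Definition is_epi X Y (f : mor X Y) :=
  forall W (g h : mor Y W), g \oc f = h \oc f -> g = h.

Definition is_zero X :=
  forall Y, (forall f : mor X Y, f = 0) /\ (forall f : mor Y X, f = 0).

Definition is_kernel X Y K (f : mor X Y) (i : mor K X) :=
  f \oc i = 0 /\
  forall W (g : mor W X), f \oc g = 0 -> exists! h : mor W K, i \oc h = g.

Definition is_cokernel X Y Q (f : mor X Y) (q : mor Y Q) :=
  q \oc f = 0 /\
  forall W (g : mor Y W), g \oc f = 0 -> exists! h : mor Q W, h \oc q = g.

Definition short_exact X Y Z (f : mor X Y) (g : mor Y Z) :=
  is_kernel g f /\ is_cokernel f g.

Definition is_biproduct X Y S (i1 : mor X S) (i2 : mor Y S)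
    (p1 : mor S X) (p2 : mor S Y) :=
  [/\ p1 \oc i1 = idm X, p2 \oc i2 = idm Y, p1 \oc i2 = 0, p2 \oc i1 = 0
    & i1 \oc p1 + i2 \oc p2 = idm S].

Definition simple_object X :=
  ~ is_zero X /\
  forall Y (f : mor Y X), is_mono f -> is_zero Y \/ is_iso f.

Definition projective X :=
  forall Y Z (e : mor Y Z) (f : mor X Z), is_epi e ->
  exists g : mor X Y, e \oc g = f.

Definition essential_epi X Y (p : mor X Y) :=
  is_epi p /\ forall W (g : mor W X), is_epi (p \oc g) -> is_epi g.

Definition projective_cover P X :=
  projective P /\ exists p : mor P X, essential_epi p.

(** [composition_series X s]: there is a filtration
    [0 = X_0 <= X_1 <= ... <= X_n = X] whose successive quotients are the simple
    objects listed in [s], from the top quotient down. *)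
Inductive composition_series : C -> seq C -> Prop :=
| CompositionZero X : is_zero X -> composition_series X [::]
| CompositionStep Y X S (i : mor Y X) (q : mor X S) s :
    short_exact i q -> simple_object S -> composition_series Y s ->
    composition_series X (S :: s).

(** Well defined by the Jordan-Hoelder theorem as soon as [X] has finite length;
    the value is [0] when [X] has no composition series. *)
Definition mult X V : nat :=
  xget 0%N [set n | exists2 s, composition_series X s
                             & n = count (fun S => `[< iso S V >]) s].

Definition simple_representatives n (V : 'I_n -> C) :=
  [/\ forall i, simple_object (V i),
      forall i j, iso (V i) (V j) -> i = j
    & forall S, simple_object S -> exists i, iso S (V i)].

End InACategory.

Definition abelian_cat (k : fieldType) (C : lincat k) :=
  [/\ exists Z : C, is_zero Z,
      forall X Y : C, exists (S : C) (i1 : mor X S) (i2 : mor Y S)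
        (p1 : mor S X) (p2 : mor S Y), is_biproduct i1 i2 p1 p2,
      forall (X Y : C) (f : mor X Y),
        (exists (K : C) (i : mor K X), is_kernel f i) /\
        (exists (Q : C) (q : mor Y Q), is_cokernel f q),
      forall (X Y : C) (f : mor X Y), is_mono f ->
        exists (Z : C) (g : mor Y Z), is_kernel g f
    & forall (X Y : C) (f : mor X Y), is_epi f ->
        exists (Z : C) (g : mor Z X), is_cokernel g f].

(** * Linear functors and bilinear bifunctors *)

Record functor (k : fieldType) (C D : lincat k) := Functor {
  fob :> C -> D;
  fmor : forall X Y : C, mor X Y -> mor (fob X) (fob Y);
  fmor_id : forall X : C, fmor (idm X) = idm (fob X);
  fmor_comp : forall (X Y Z : C) (g : mor Y Z) (f : mor X Y),
    fmor (g \oc f) = fmor g \oc fmor f;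
  fmor_lin : forall X Y : C, linear (@fmor X Y)
}.

Arguments fmor {k C D} F {X Y} f : rename.

Record bifunctor (k : fieldType) (B C D : lincat k) := Bifunctor {
  bob :> B -> C -> D;
  bmor : forall (X X' : B) (Y Y' : C),
    mor X X' -> mor Y Y' -> mor (bob X Y) (bob X' Y');
  bmor_id : forall (X : B) (Y : C), bmor (idm X) (idm Y) = idm (bob X Y);
  bmor_comp : forall (X X' X'' : B) (Y Y' Y'' : C)
    (f' : mor X' X'') (f : mor X X') (g' : mor Y' Y'') (g : mor Y Y'),
    bmor (f' \oc f) (g' \oc g) = bmor f' g' \oc bmor f g;
  bmor_linl : forall (X X' : B) (Y Y' : C) (g : mor Y Y'),
    linear (fun f : mor X X' => bmor f g);
  bmor_linr : forall (X X' : B) (Y Y' : C) (f : mor X X'),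
    linear (fun g : mor Y Y' => bmor f g)
}.

Arguments bmor {k B C D} T {X X' Y Y'} f g : rename.

Section Functors.
Context {k : fieldType}.
Implicit Types A B C D : lincat k.

Program Definition id_functor C : functor C C :=
  {| fob := id; fmor := fun _ _ f => f |}.
Next Obligation. by []. Qed.

Program Definition comp_functor B C D (G : functor C D) (F : functor B C) :
    functor B D :=
  {| fob := fun X => G (F X); fmor := fun _ _ f => fmor G (fmor F f) |}.
Next Obligation. by move=> *; rewrite !fmor_id. Qed.
Next Obligation. by move=> *; rewrite !fmor_comp. Qed.
Next Obligation. by move=> * ? ? /=; rewrite !fmor_lin. Qed.

Program Definition comp_bifunctor A B C D (G : functor C D)
    (T : bifunctor A B C) : bifunctor A B D :=
  {| bob := fun X Y => G (T X Y); bmor := fun _ _ _ _ f g => fmor G (bmor T f g) |}.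
Next Obligation. by move=> *; rewrite bmor_id fmor_id. Qed.
Next Obligation. by move=> *; rewrite bmor_comp fmor_comp. Qed.
Next Obligation. by move=> * ? ? /=; rewrite bmor_linl fmor_lin. Qed.
Next Obligation. by move=> * ? ? /=; rewrite bmor_linr fmor_lin. Qed.

Program Definition partial_l B C D (T : bifunctor B C D) (Y : C) : functor B D :=
  {| fob := fun X => T X Y; fmor := fun _ _ f => bmor T f (idm Y) |}.
Next Obligation. by move=> *; rewrite bmor_id. Qed.
Next Obligation. by move=> *; rewrite -bmor_comp comp1m. Qed.
Next Obligation. by move=> * ? ? /=; rewrite bmor_linl. Qed.

Program Definition partial_r B C D (T : bifunctor B C D) (X : B) : functor C D :=
  {| fob := fun Y => T X Y; fmor := fun _ _ g => bmor T (idm X) g |}.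
Next Obligation. by move=> *; rewrite bmor_id. Qed.
Next Obligation. by move=> *; rewrite -bmor_comp comp1m. Qed.
Next Obligation. by move=> * ? ? /=; rewrite bmor_linr. Qed.

Definition natural C D (F G : functor C D) (eta : forall X, mor (F X) (G X)) :=
  forall X Y (f : mor X Y), fmor G f \oc eta X = eta Y \oc fmor F f.

Definition nat_iso C D (F G : functor C D) :=
  exists eta : forall X, mor (F X) (G X), natural eta /\ forall X, is_iso (eta X).

Definition binatural B C D (S T : bifunctor B C D)
    (eta : forall X Y, mor (S X Y) (T X Y)) :=
  forall X X' Y Y' (f : mor X X') (g : mor Y Y'),
    bmor T f g \oc eta X Y = eta X' Y' \oc bmor S f g.

Definition binat_iso B C D (S T : bifunctor B C D) :=
  exists eta : forall X Y, mor (S X Y) (T X Y),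
    binatural eta /\ forall X Y, is_iso (eta X Y).

Definition equivalent C D :=
  exists (F : functor C D) (G : functor D C),
    nat_iso (comp_functor G F) (id_functor C) /\
    nat_iso (comp_functor F G) (id_functor D).

Definition left_exact C D (F : functor C D) :=
  forall (K X Y : C) (f : mor X Y) (i : mor K X),
    is_kernel f i -> is_kernel (fmor F f) (fmor F i).

Definition right_exact C D (F : functor C D) :=
  forall (X Y Q : C) (f : mor X Y) (q : mor Y Q),
    is_cokernel f q -> is_cokernel (fmor F f) (fmor F q).

Definition biright_exact B C D (T : bifunctor B C D) :=
  (forall Y, right_exact (partial_l T Y)) /\ (forall X, right_exact (partial_r T X)).

(** Deligne's universal property: [D] is abelian, [T] is right exact in each
    variable, and for every linear abelian category [A] restriction along [T]
    is an equivalence (essentially surjective and fully faithful) from the right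
    exact functors [D -> A] to the bifunctors [B * C -> A] right exact in each
    variable. *)
Definition deligne_product B C D (T : bifunctor B C D) :=
  [/\ abelian_cat D, biright_exact T
    & forall A, abelian_cat A ->
      (forall S : bifunctor B C A, biright_exact S ->
         exists G : functor D A,
           right_exact G /\ binat_iso (comp_bifunctor G T) S) /\
      (forall G H : functor D A, right_exact G -> right_exact H ->
         forall theta : (forall X Y, mor (G (T X Y)) (H (T X Y))),
         @binatural B C A (comp_bifunctor G T) (comp_bifunctor H T) theta ->
         exists! eta : (forall Z, mor (G Z) (H Z)),
           natural eta /\ forall X Y, eta (T X Y) = theta X Y)].

End Functors.

(** * The category of finite-dimensional modules over an algebra *)

Section Modules.
Context {k : fieldType} (A : falgType k).

Record fdmodule := FdModule {
  fdsort :> vectType k;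
  fdact : {linear A -> 'End(fdsort)};
  fdact1 : fdact 1 = \1%VF;
  fdactM : forall a b, fdact (a * b) = (fdact a \o fdact b)%VF
}.

Definition intertwines (V W : fdmodule) : {pred 'Hom(V, W)} :=
  fun f => `[< forall a, (f \o fdact V a)%VF = (fdact W a \o f)%VF >].

Lemma intertwines_submod V W : submod_closed (@intertwines V W).
Proof.
split=> [|c f g /asboolP fA /asboolP gA]; apply/asboolP=> a.
  by rewrite comp_lfun0l comp_lfun0r.
by rewrite comp_lfunDl comp_lfunDr -comp_lfunZl -comp_lfunZr fA gA.
Qed.

HB.instance Definition _ (V W : fdmodule) :=
  GRing.isSubmodClosed.Build k 'Hom(V, W) (@intertwines V W)
    (intertwines_submod V W).

Record mhom (V W : fdmodule) := MHom {
  mhom_val :> 'Hom(V, W);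
  mhomP : mhom_val \in @intertwines V W
}.

HB.instance Definition _ (V W : fdmodule) := [isSub for @mhom_val V W].
HB.instance Definition _ (V W : fdmodule) := [Choice of mhom V W by <:].
HB.instance Definition _ (V W : fdmodule) := [SubChoice_isSubLmodule of mhom V W by <:].

Lemma mhom1P V : \1%VF \in @intertwines V V.
Proof. by apply/asboolP=> a; rewrite comp_lfun1l comp_lfun1r. Qed.

Lemma mhom_compP U V W (g : mhom V W) (f : mhom U V) :
  (g \o f)%VF \in @intertwines U W.
Proof.
apply/asboolP=> a; move/asboolP: (mhomP g) => gA; move/asboolP: (mhomP f) => fA.
by rewrite -comp_lfunA fA comp_lfunA gA comp_lfunA.
Qed.

Program Definition modcat : lincat k :=
  {| ob := fdmodule;
     mor := mhom;
     idm := fun V => MHom (mhom1P V);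
     mcomp := fun U V W g f => MHom (mhom_compP g f) |}.
Next Obligation. by move=> *; apply/val_inj/comp_lfun1l. Qed.
Next Obligation. by move=> *; apply/val_inj/comp_lfun1r. Qed.
Next Obligation. by move=> *; apply/val_inj/comp_lfunA. Qed.
Next Obligation.
by move=> * ? ?; apply/val_inj; rewrite /= comp_lfunDl -comp_lfunZl.
Qed.
Next Obligation.
by move=> * ? ?; apply/val_inj; rewrite /= comp_lfunDr -comp_lfunZr.
Qed.

End Modules.

(** * Finite tensor categories *)

Record monoidal (k : fieldType) (C : lincat k) := Monoidal {
  tens : bifunctor C C C;
  unit_ob : C;
  assoc : forall X Y Z, mor (tens (tens X Y) Z) (tens X (tens Y Z));
  assoc' : forall X Y Z, mor (tens X (tens Y Z)) (tens (tens X Y) Z);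
  lunit : forall X, mor (tens unit_ob X) X;
  lunit' : forall X, mor X (tens unit_ob X);
  runit : forall X, mor (tens X unit_ob) X;
  runit' : forall X, mor X (tens X unit_ob);
  assocK : forall X Y Z, assoc' X Y Z \oc assoc X Y Z = idm _;
  assoc'K : forall X Y Z, assoc X Y Z \oc assoc' X Y Z = idm _;
  lunitK : forall X, lunit' X \oc lunit X = idm _;
  lunit'K : forall X, lunit X \oc lunit' X = idm _;
  runitK : forall X, runit' X \oc runit X = idm _;
  runit'K : forall X, runit X \oc runit' X = idm _;
  assoc_nat : forall X X' Y Y' Z Z'
      (f : mor X X') (g : mor Y Y') (h : mor Z Z'),
    bmor tens f (bmor tens g h) \oc assoc X Y Z
    = assoc X' Y' Z' \oc bmor tens (bmor tens f g) h;
  lunit_nat : forall X X' (f : mor X X'),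
    f \oc lunit X = lunit X' \oc bmor tens (idm unit_ob) f;
  runit_nat : forall X X' (f : mor X X'),
    f \oc runit X = runit X' \oc bmor tens f (idm unit_ob);
  pentagon : forall X Y Z W,
    assoc X Y (tens Z W) \oc assoc (tens X Y) Z W
    = bmor tens (idm X) (assoc Y Z W) \oc assoc X (tens Y Z) W
        \oc bmor tens (assoc X Y Z) (idm W);
  triangle : forall X Y,
    bmor tens (idm X) (lunit Y) \oc assoc X unit_ob Y = bmor tens (runit X) (idm Y)
}.

(** Data exhibiting [D] as a left dual of [X]; equivalently, [X] as a right dual
    of [D]. *)
Record duality (k : fieldType) (C : lincat k) (M : monoidal C) (D X : C) :=
Duality {
  ev : mor (tens M D X) (unit_ob M);
  coev : mor (unit_ob M) (tens M X D);
  zigzag_r : runit M X \oc bmor (tens M) (idm X) ev \oc assoc M X D X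
    \oc bmor (tens M) coev (idm X) \oc lunit' M X = idm X;
  zigzag_l : lunit M D \oc bmor (tens M) ev (idm D) \oc assoc' M D X D
    \oc bmor (tens M) (idm D) coev \oc runit' M D = idm D
}.

Record finTensorCat (k : fieldType) := FinTensorCat {
  ftc_cat :> lincat k;
  ftc_monoidal : monoidal ftc_cat;
  ldual : ftc_cat -> ftc_cat;
  ldualP : forall X, duality ftc_monoidal (ldual X) X;
  rdual : ftc_cat -> ftc_cat;
  rdualP : forall X, duality ftc_monoidal X (rdual X);
  ftc_finite : exists A : falgType k, equivalent ftc_cat (modcat A);
  ftc_unit : bijective (fun c : k => c *: idm (unit_ob ftc_monoidal))
}.

Section Coend.
Context {k : fieldType} {C : finTensorCat k}.
Local Notation M := (ftc_monoidal C).
Local Notation T := (tens M).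

(** The transpose [*f : *Y -> *X] of [f : X -> Y], that is
    [*Y -> 1 *Y -> ( *X X) *Y -> ( *X Y) *Y -> *X (Y *Y) -> *X 1 -> *X]. *)
Definition rdual_mor (X Y : C) (f : mor X Y) : mor (rdual Y) (rdual X) :=
  runit M (rdual X)
  \oc bmor T (idm (rdual X)) (ev (rdualP Y))
  \oc assoc M (rdual X) Y (rdual Y)
  \oc bmor T (bmor T (idm (rdual X)) f) (idm (rdual Y))
  \oc bmor T (coev (rdualP X)) (idm (rdual Y))
  \oc lunit' M (rdual Y).

Context {D : lincat k} (box : bifunctor C C D) (F : functor C C).

Definition dinatural (E : D) (iota : forall X : C, mor (box (rdual X) (F X)) E) :=
  forall (X Y : C) (f : mor X Y),
    iota X \oc bmor box (rdual_mor f) (idm (F X))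
    = iota Y \oc bmor box (idm (rdual Y)) (fmor F f).

(** [E], with the dinatural family [iota], is the coend of [ *X box F(X)]. *)
Definition is_coend (E : D) (iota : forall X : C, mor (box (rdual X) (F X)) E) :=
  dinatural iota /\
  forall (W : D) (kappa : forall X : C, mor (box (rdual X) (F X)) W),
    dinatural kappa ->
    exists! h : mor E W, forall X, h \oc iota X = kappa X.

End Coend.

(** * The Grothendieck group *)

Section Grothendieck.
Context {k : fieldType} (D : lincat k).

(** The free abelian group on the objects of [D] consists of the finite integer
    combinations of the [gen X] below. It is kept as a set of functions, without a
    [zmodType] structure, because the objects of a [lincat] may live in a larger
    universe than the carriers of MathComp structures (those of [modcat] do). *)
Definition formal_sum := D -> int.

Definition gen (X : D) : formal_sum := fun W => `[< X = W >]%:R.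

(** The subgroup generated by [Y] - [X] - [Z] for [0 -> X -> Y -> Z -> 0] exact. *)
Inductive exact_relations : formal_sum -> Prop :=
| ExactRelation X Y Z (f : mor X Y) (g : mor Y Z) :
    short_exact f g ->
    exact_relations (fun W => gen Y W - gen X W - gen Z W)
| ExactZero : exact_relations (fun=> 0)
| ExactSub a b : exact_relations a -> exact_relations b ->
    exact_relations (fun W => a W - b W).

(** The element of [Gr D] represented by [a], that is, the coset of [a] modulo
    [exact_relations]. *)
Definition Gr_coset (a : formal_sum) : formal_sum -> Prop :=
  fun b => exact_relations (fun W => b W - a W).

End Grothendieck.

(* Main.v *)
(** For [P] projective in [C], the universal property of the
    Deligne product yields a right exact functor [Phi : CC -> C] with
    [Phi (box X Y) = Hom(P, X) . Y]. Full faithfulness of restriction along [box] turns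
    formulas on the objects [box X Y] into natural transformations, and gives adjunctions
    [box P - -| Phi -| box I -], where [I] represents [X |-> Hom(P, X)^*]. The left adjoint
    shows that the [box (P i) (P j)] are projective and generate [CC], so that every object [Z]
    is worth the sum of the [dim Hom(box (P i) (P j), Z)] times [box (V i) (V j)] in the
    Grothendieck group. As a left adjoint, [Phi] preserves the coend; since
    [Hom(P, *X) = Hom(X, P^* )], the Yoneda lemma identifies [Phi E] with [F (P^* )]. Hence
    [dim Hom(box (P i) (P j), E) = dim Hom(P j, F ((P i)^* )) = mult (F ((P i)^* )) (V j)]. *)
From HB Require Import structures.
Require Import Defs.
From mathcomp Require Import all_boot all_order all_algebra all_field.
From mathcomp Require Import boolp classical_sets.

Set Implicit Arguments.
Unset Strict Implicit.
Unset Printing Implicit Defensive.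
Import GRing.Theory.
Local Open Scope ring_scope.

(** * Bases of vector spaces *)

Section LinearMaps.
Context {k : fieldType}.
Implicit Types U V W : lmodType k.

(** The Deligne product is available only through its universal property: nothing says in advance
    that its objects have finite length, that its morphism spaces are finite-dimensional, or that
    [box (V i) (V j)] is simple. All of this is replaced by morphism spaces out of the
    [box (P i) (P j)], which the adjunction moves back into [C]. The universal property classifies
    right exact functors only; projectivity of [P] is what makes [Hom(P, X) . Y] right exact in [X].
    The right adjoint is needed because the coend controls maps out of [E], whereas identifying
    [Phi E] requires control of maps out of [Phi E]. Its object [I] is the value at [P] of the
    Nakayama functor: over an algebra [A] it is the dual of [Hom_A(P, A)], and [tau] is the trace
    form given by the dual basis lemma. Modules serve for this, for abelianness, and for finite
    dimension and length, all carried over to [C] by the equivalence. Algebraic closedness makes the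
    endomorphisms of simple objects scalars, so that multiplicities are dimensions of morphism
    spaces over [k]. *)

Lemma linear_add U V (f : U -> V) : linear f -> {morph f : u v / u + v}.
Proof. by move=> fL u v; have := fL 1 u v; rewrite !scale1r. Qed.

Lemma linear_zero U V (f : U -> V) : linear f -> f 0 = 0.
Proof. by move=> fL; apply: (addrI (f 0)); rewrite -(linear_add fL) !addr0. Qed.

Lemma linear_scale U V (f : U -> V) : linear f -> forall a u, f (a *: u) = a *: f u.
Proof. by move=> fL a u; have := fL a u 0; rewrite !addr0 (linear_zero fL) addr0. Qed.

Lemma linear_opp U V (f : U -> V) : linear f -> {morph f : u / - u}.
Proof. by move=> fL u; rewrite -scaleN1r (linear_scale fL) scaleN1r. Qed.

Lemma linear_sub U V (f : U -> V) : linear f -> {morph f : u v / u - v}.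
Proof. by move=> fL u v; rewrite (linear_add fL) (linear_opp fL). Qed.

Lemma linear_bigsum U V (f : U -> V) : linear f ->
  forall I (r : seq I) (P : pred I) (F : I -> U),
    f (\sum_(i <- r | P i) F i) = \sum_(i <- r | P i) f (F i).
Proof. by move=> fL I r P F; apply: (big_morph f (linear_add fL) (linear_zero fL)). Qed.

Lemma linear_inj_ker U V (f : U -> V) :
  linear f -> (forall u, f u = 0 -> u = 0) -> injective f.
Proof.
move=> fL f0 u v fuv; apply/eqP; rewrite -subr_eq0; apply/eqP/f0.
by rewrite (linear_sub fL) fuv subrr.
Qed.

(** Morphism spaces are bare [lmodType]s, so finite dimension is recorded as a family [e] together
    with its dual coordinate forms [c]. Copowers, counits and representing objects are later written
    with these forms. *)
Definition basis U n (e : 'I_n -> U) (c : 'I_n -> U -> k) :=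
  [/\ forall a, linear (c a : U -> k^o),
      forall u, u = \sum_a c a u *: e a
    & forall a b, c a (e b) = (a == b)%:R].

Definition has_dim U n := exists (e : 'I_n -> U) c, basis e c.

Lemma basis_linear_sum U V n (e : 'I_n -> U) c (f : U -> V) u :
  basis e c -> linear f -> f u = \sum_a c a u *: f (e a).
Proof.
move=> [_ eS _] fL; rewrite {1}(eS u) (linear_bigsum fL).
by apply: eq_bigr => a _; rewrite (linear_scale fL).
Qed.

Lemma basis_coord U n (e : 'I_n -> U) c (v : 'I_n -> k) b :
  basis e c -> c b (\sum_a v a *: e a) = v b.
Proof.
move=> [cL _ cE]; rewrite (linear_bigsum (cL b)) (bigD1 b) //=.
rewrite (linear_scale (cL b)) cE eqxx big1 => [|a /negPf nab].
  by rewrite addr0; apply: mulr1.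
by rewrite (linear_scale (cL b)) cE eq_sym nab; apply: mulr0.
Qed.

(** The two change-of-basis matrices multiply to the identity of size [n], whose rank is at most [p]
    since the second factor has only [p] rows. *)
Lemma has_dim_le U n p : has_dim U n -> has_dim U p -> (n <= p)%N.
Proof.
move=> [e [c eP]] [e' [c' eP']].
pose M := \matrix_(a < n, b < p) c a (e' b).
pose N := \matrix_(b < p, a < n) c' b (e a).
have MN : M *m N = 1%:M.
  apply/matrixP=> a a'; rewrite !mxE.
  have [cL _ cE] := eP; rewrite -cE (basis_linear_sum (e a') eP' (cL a)).
  by apply: eq_bigr => b _; rewrite !mxE mulrC.
by rewrite -(mxrank1 k n) -MN (leq_trans (mxrankM_maxr _ _)) // rank_leq_row.
Qed.

Lemma has_dim_unique U n p : has_dim U n -> has_dim U p -> n = p.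
Proof. by move=> Un Up; apply/eqP; rewrite eqn_leq !(@has_dim_le U). Qed.

Lemma has_dim_bij U V n (f : U -> V) (g : V -> U) :
  linear f -> cancel f g -> cancel g f -> has_dim U n -> has_dim V n.
Proof.
move=> fL fK gK [e [c [cL eS cE]]].
have gL : linear g by move=> a u v; apply: (can_inj fK); rewrite fL !gK.
exists (f \o e), (fun a => c a \o g); split=> [a b u v|v|a b] /=.
- by rewrite gL cL.
- rewrite -{1}(gK v) (eS (g v)) (linear_bigsum fL).
  by apply: eq_bigr => a _; rewrite (linear_scale fL) -eS.
- by rewrite fK cE.
Qed.

Lemma has_dim0P U : has_dim U 0 <-> forall u : U, u = 0.
Proof.
split=> [[e [c [_ eS _]]] u|U0]; first by rewrite (eS u) big_ord0.
exists (fun=> 0), (fun _ _ => 0); split=> [a|u|[]//]; last by rewrite big_ord0.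
by case: a.
Qed.

Lemma has_dim1 U (e : U) :
  (forall u, exists c, u = c *: e) -> e != 0 -> has_dim U 1.
Proof.
move=> /choice[c cE] e0.
exists (fun=> e), (fun=> c); split=> [_ a u v|u|a b].
- have : (c (a *: u + v) - (a * c u + c v)) *: e = 0.
    by rewrite scalerBl scalerDl -scalerA -!cE subrr.
  by move/eqP; rewrite scaler_eq0 (negPf e0) orbF subr_eq0 => /eqP.
- by rewrite big_ord1.
- have := cE e; rewrite !ord1 eqxx -[LHS]scale1r => /eqP.
  by rewrite -subr_eq0 -scalerBl scaler_eq0 (negPf e0) orbF subr_eq0 => /eqP <-.
Qed.

Lemma has_dim1P U : has_dim U 1 ->
  exists2 e : U, e != 0 & forall u, exists c, u = c *: e.
Proof.
move=> [e [c [cL eS cE]]]; exists (e ord0) => [|u]; last first.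
  by exists (c ord0 u); rewrite {1}(eS u) big_ord1.
apply/eqP=> e0; have := cE ord0 ord0.
rewrite e0 eqxx (linear_zero (cL _)) => /eqP.
by rewrite eq_sym oner_eq0.
Qed.

(** A basis of [V] is glued from the image of a basis of [U] and lifts [s] of a basis of [W]. The
    map [t] is [g] followed by the section given by [s], and [r] is the resulting retraction of [f],
    which supplies the first coordinates. *)
Lemma has_dim_ext U V W n p (f : U -> V) (g : V -> W) :
  linear f -> linear g -> injective f -> (forall w, exists v, g v = w) ->
  (forall v, g v = 0 <-> exists u, f u = v) ->
  has_dim U n -> has_dim W p -> has_dim V (n + p).
Proof.
move=> fL gL fI gS fg [e [c [cL eS cE]]] [d [b [bL dS bE]]].
have [s sE] := choice (fun a => gS (d a)).
pose t v := \sum_a b a (g v) *: s a.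
have tL : linear t.
  move=> x u v; rewrite /t scaler_sumr -big_split; apply: eq_bigr => a _ /=.
  by rewrite gL bL scalerDl scalerA.
have gt v : g (t v) = g v.
  rewrite /t (linear_bigsum gL) {2}(dS (g v)).
  by apply: eq_bigr => a _; rewrite (linear_scale gL) sE.
have /choice[r rE] v : exists u, f u = v - t v.
  by apply/fg; rewrite (linear_sub gL) gt subrr.
have rL : linear r.
  move=> x u v; apply: fI; rewrite fL !rE tL scalerBr -!addrA; congr (_ + _).
  by rewrite opprD addrCA.
have gf u : g (f u) = 0 by apply/fg; exists u.
have tf u : t (f u) = 0.
  by rewrite /t gf big1 // => a _; rewrite (linear_zero (bL a)) scale0r.
have rf u : r (f u) = u by apply: fI; rewrite rE tf subr0.
have ts a : t (s a) = s a.
  rewrite /t sE (bigD1 a) //= bE eqxx scale1r big1 ?addr0 // => a' /negPf na.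
  by rewrite bE na scale0r.
have rs a : r (s a) = 0 by apply: fI; rewrite rE ts subrr (linear_zero fL).
exists (fun a => match split a with inl x => f (e x) | inr y => s y end).
exists (fun a v => match split a with inl x => c x (r v) | inr y => b y (g v) end).
split=> [a x u v|v|a a'].
- by case: (split a) => y; rewrite ?rL ?gL ?cL ?bL.
- rewrite big_split_ord /= -{1}[v](subrK (t v)) -rE {1}(eS (r v)) (linear_bigsum fL).
  congr (_ + _); apply: eq_bigr => a _.
    by rewrite (linear_scale fL) (unsplitK (inl a)).
  by rewrite (unsplitK (inr a)).
- rewrite -[in RHS](splitK a) -[in RHS](splitK a').
  case: (split a) => x; case: (split a') => y /=.
  + by rewrite rf cE eq_lshift.
  + by rewrite rs (linear_zero (cL x)) eq_lrshift.
  + by rewrite gf (linear_zero (bL x)) eq_rlshift.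
  + by rewrite sE bE eq_rshift.
Qed.

(** A subspace of largest dimension among those contained in [P] is all of [P], since any further
    vector satisfying [P] would enlarge it. *)
Lemma vspace_of_closed (vT : vectType k) (P : vT -> Prop) :
  P 0 -> (forall a u v, P u -> P v -> P (a *: u + v)) ->
  exists W : {vspace vT}, forall v, v \in W <-> P v.
Proof.
move=> P0 PL.
pose Q n := `[< exists2 W : {vspace vT}, \dim W = n & forall v, v \in W -> P v >].
have exQ : exists n, Q n.
  exists 0%N; apply/asboolP; exists 0%VS; first exact: dimv0.
  by move=> v; rewrite memv0 => /eqP ->.
have leQ n : Q n -> (n <= \dim {:vT})%N by move=> /asboolP[W <- _]; apply/dimvS/subvf.
have [n /asboolP[W dimW WP] maxW] := ex_maxnP exQ leQ.
exists W => v; split=> [/WP //|Pv].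
have sub : (W <= W + <[v]>)%VS by apply: addvSl.
have : (\dim (W + <[v]>) <= n)%N.
  apply: maxW; apply/asboolP; exists (W + <[v]>)%VS => //.
  move=> _ /memv_addP[w /WP Pw [_ /vlineP[a ->] ->]].
  by rewrite addrC; apply: PL.
rewrite -dimW (geq_leqif (dimv_leqif_eq sub)) => /eqP ->.
by rewrite memvE addvSr.
Qed.

Lemma has_dim_sub (vT : vectType k) U (f : U -> vT) :
  linear f -> injective f -> exists n, has_dim U n.
Proof.
move=> fL fI.
have [W WP] : exists W : {vspace vT}, forall v, v \in W <-> exists u, f u = v.
  apply: vspace_of_closed; first by exists 0; rewrite (linear_zero fL).
  by move=> a _ _ [u <-] [v <-]; exists (a *: u + v); rewrite fL.
have /choice[e eE] a : exists u, f u = (vbasis W)`_a.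
  have [a_lt|a_ge] := ltnP a (\dim W).
    by apply/WP/vbasis_mem/mem_nth; rewrite size_tuple.
  by exists 0; rewrite nth_default ?size_tuple // (linear_zero fL).
exists (\dim W), (fun a => e a), (fun a u => coord (vbasis W) a (f u)).
split=> [a x u v|u|a b].
- by rewrite fL linearP.
- have fW : f u \in W by apply/WP; exists u.
  apply: fI; rewrite (linear_bigsum fL) {1}(coord_vbasis fW).
  by apply: eq_bigr => a _; rewrite (linear_scale fL) eE.
- by rewrite eE coord_free ?(basis_free (vbasisP W)) // eq_sym.
Qed.

Lemma has_dim_vect (vT : vectType k) : has_dim vT (\dim {:vT}).
Proof.
exists (fun a => (vbasis {:vT})`_a), (fun a u => coord (vbasis {:vT}) a u).
split=> [a x u v|u|a b]; first by rewrite linearP.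
  by apply: coord_vbasis; rewrite memvf.
by rewrite coord_free ?(basis_free (vbasisP _)) // eq_sym.
Qed.

End LinearMaps.

(** * Linear and abelian categories *)

Section LinearCategories.
Context {k : fieldType} {C : lincat k}.
Implicit Types X Y Z W S : C.

Lemma mcompA X Y Z W (h : mor Z W) (g : mor Y Z) (f : mor X Y) :
  h \oc (g \oc f) = h \oc g \oc f.
Proof. exact: Defs.compA. Qed.
Lemma compDl X Y Z (g g' : mor Y Z) (f : mor X Y) : (g + g') \oc f = g \oc f + g' \oc f.
Proof. exact: (linear_add (comp_linl f)). Qed.
Lemma compDr X Y Z (g : mor Y Z) (f f' : mor X Y) : g \oc (f + f') = g \oc f + g \oc f'.
Proof. exact: (linear_add (comp_linr g)). Qed.
Lemma compBl X Y Z (g g' : mor Y Z) (f : mor X Y) : (g - g') \oc f = g \oc f - g' \oc f.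
Proof. exact: (linear_sub (comp_linl f)). Qed.
Lemma compBr X Y Z (g : mor Y Z) (f f' : mor X Y) : g \oc (f - f') = g \oc f - g \oc f'.
Proof. exact: (linear_sub (comp_linr g)). Qed.
Lemma comp0m X Y Z (f : mor X Y) : (0 : mor Y Z) \oc f = 0.
Proof. exact: (linear_zero (comp_linl f)). Qed.
Lemma compm0 X Y Z (g : mor Y Z) : g \oc (0 : mor X Y) = 0.
Proof. exact: (linear_zero (comp_linr g)). Qed.
Lemma compZl X Y Z a (g : mor Y Z) (f : mor X Y) : (a *: g) \oc f = a *: (g \oc f).
Proof. exact: (linear_scale (comp_linl f)). Qed.
Lemma compZr X Y Z a (g : mor Y Z) (f : mor X Y) : g \oc (a *: f) = a *: (g \oc f).
Proof. exact: (linear_scale (comp_linr g)). Qed.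
Lemma comp_suml X Y Z I (r : seq I) (P : pred I) (g : I -> mor Y Z) (f : mor X Y) :
  (\sum_(i <- r | P i) g i) \oc f = \sum_(i <- r | P i) (g i \oc f).
Proof. exact: (linear_bigsum (comp_linl f)). Qed.
Lemma comp_sumr X Y Z I (r : seq I) (P : pred I) (g : mor Y Z) (f : I -> mor X Y) :
  g \oc (\sum_(i <- r | P i) f i) = \sum_(i <- r | P i) (g \oc f i).
Proof. exact: (linear_bigsum (comp_linr g)). Qed.

Lemma is_zeroP X : is_zero X <-> idm X = 0.
Proof.
split=> [X0|X0 Y]; first exact: (X0 X).1.
split=> f; first by rewrite -(compm1 f) X0 compm0.
by rewrite -(comp1m f) X0 comp0m.
Qed.

Lemma epiP X Y (f : mor X Y) :
  is_epi f <-> forall W (g : mor Y W), g \oc f = 0 -> g = 0.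
Proof.
split=> [fE W g gf|fE W g h gh]; first by apply: fE; rewrite gf comp0m.
by apply/eqP; rewrite -subr_eq0; apply/eqP/fE; rewrite compBl gh subrr.
Qed.

Lemma monoP X Y (f : mor X Y) :
  is_mono f <-> forall W (g : mor W X), f \oc g = 0 -> g = 0.
Proof.
split=> [fM W g fg|fM W g h gh]; first by apply: fM; rewrite fg compm0.
by apply/eqP; rewrite -subr_eq0; apply/eqP/fM; rewrite compBr gh subrr.
Qed.

Lemma cokernel_epi X Y Q (f : mor X Y) (q : mor Y Q) : is_cokernel f q -> is_epi q.
Proof.
move=> [qf qU] W g h gh.
have [|t [_ tU]] := qU W (h \oc q); first by rewrite -mcompA qf compm0.
by rewrite -(tU g gh) -(tU h).
Qed.

Lemma kernel_mono X Y K (f : mor X Y) (i : mor K X) : is_kernel f i -> is_mono i.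
Proof.
move=> [fi iU] W g h gh.
have [|t [_ tU]] := iU W (i \oc h); first by rewrite mcompA fi comp0m.
by rewrite -(tU g gh) -(tU h).
Qed.

Lemma cokernelI X Y Q (f : mor X Y) (q : mor Y Q) : q \oc f = 0 -> is_epi q ->
  (forall W (g : mor Y W), g \oc f = 0 -> exists h, h \oc q = g) -> is_cokernel f q.
Proof.
move=> qf qE qU; split=> // W g /qU[h hq]; exists h; split=> // h' h'q.
by apply: qE; rewrite hq.
Qed.

Lemma kernelI X Y K (f : mor X Y) (i : mor K X) : f \oc i = 0 -> is_mono i ->
  (forall W (g : mor W X), f \oc g = 0 -> exists h, i \oc h = g) -> is_kernel f i.
Proof.
move=> fi iM iU; split=> // W g /iU[h hq]; exists h; split=> // h' h'q.
by apply: iM; rewrite hq.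
Qed.

Lemma cokernel_factor X Y Q (f : mor X Y) (q : mor Y Q) W (g : mor Y W) :
  is_cokernel f q -> g \oc f = 0 -> exists h, h \oc q = g.
Proof. by move=> [_ qU] /qU[h [hq _]]; exists h. Qed.

Lemma kernel_factor X Y K (f : mor X Y) (i : mor K X) W (g : mor W X) :
  is_kernel f i -> f \oc g = 0 -> exists h, i \oc h = g.
Proof. by move=> [_ iU] /iU[h [hq _]]; exists h. Qed.

Lemma epi_comp X Y Z (g : mor Y Z) (f : mor X Y) : is_epi g -> is_epi f -> is_epi (g \oc f).
Proof. by move=> gE fE W h h'; rewrite !mcompA => /fE/gE. Qed.

Lemma epi_compl X Y Z (g : mor Y Z) (f : mor X Y) : is_epi (g \oc f) -> is_epi g.
Proof. by move=> gfE W h h' hh; apply: gfE; rewrite !mcompA hh. Qed.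

Lemma iso_epi X Y (f : mor X Y) : is_iso f -> is_epi f.
Proof. by move=> [g [_ fg]] W h h' hh; rewrite -(compm1 h) -fg mcompA hh -mcompA fg compm1. Qed.

Lemma iso_mono X Y (f : mor X Y) : is_iso f -> is_mono f.
Proof. by move=> [g [gf _]] W h h' hh; rewrite -(comp1m h) -gf -mcompA hh mcompA gf comp1m. Qed.

Lemma is_iso_comp X Y Z (g : mor Y Z) (f : mor X Y) : is_iso g -> is_iso f -> is_iso (g \oc f).
Proof.
move=> [g' [g'g gg']] [f' [f'f ff']]; exists (f' \oc g'); split.
  by rewrite mcompA -(mcompA f') g'g compm1.
by rewrite mcompA -(mcompA g) ff' compm1.
Qed.

Lemma iso_sym X Y : iso X Y -> iso Y X.
Proof. by move=> [f [g [gf fg]]]; exists g, f. Qed.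

Lemma iso_trans X Y Z : iso X Y -> iso Y Z -> iso X Z.
Proof. by move=> [f fI] [g gI]; exists (g \oc f); apply: is_iso_comp. Qed.

Lemma iso_has_dim P X Y n : iso X Y -> has_dim (mor P X) n -> has_dim (mor P Y) n.
Proof.
move=> [f [g [gf fg]]].
apply: (has_dim_bij (f := fun h => f \oc h) (g := fun h => g \oc h)).
- exact: comp_linr.
- by move=> h; rewrite mcompA gf comp1m.
- by move=> h; rewrite mcompA fg comp1m.
Qed.

Lemma projective_cokernel P X Y Q (f : mor X Y) (q : mor Y Q) (h : mor P Q) :
  projective P -> is_cokernel f q -> exists g, q \oc g = h.
Proof. by move=> PP /cokernel_epi; apply: PP. Qed.

Lemma has_dim_exact P X Y Z (f : mor X Y) (g : mor Y Z) n p :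
  projective P -> short_exact f g ->
  has_dim (mor P X) n -> has_dim (mor P Z) p -> has_dim (mor P Y) (n + p).
Proof.
move=> PP [fK gC].
apply: (has_dim_ext (f := fun h => f \oc h) (g := fun h => g \oc h)).
- exact: comp_linr.
- exact: comp_linr.
- exact: (kernel_mono fK).
- by move=> w; apply: projective_cokernel gC.
- move=> v; split=> [|[u <-]]; first exact: kernel_factor.
  by rewrite mcompA fK.1 comp0m.
Qed.

End LinearCategories.

(** * Abelian categories: simple objects and composition series *)

Section AbelianCategories.
Context {k : fieldType} {C : lincat k}.
Hypothesis (CA : abelian_cat C).
Implicit Types X Y Z W S : C.

Lemma has_kernel X Y (f : mor X Y) : exists K (i : mor K X), is_kernel f i.
Proof. by have [_ _ /(_ _ _ f)[]] := CA. Qed.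

Lemma has_cokernel X Y (f : mor X Y) : exists Q (q : mor Y Q), is_cokernel f q.
Proof. by have [_ _ /(_ _ _ f)[]] := CA. Qed.

Lemma epi_cokernel X Y K (f : mor X Y) (i : mor K X) :
  is_epi f -> is_kernel f i -> is_cokernel i f.
Proof.
move=> fE iK; have [_ _ _ _ /(_ _ _ _ fE)[Z [g gC]]] := CA.
apply: cokernelI => // [|W h hi]; first exact: iK.1.
apply: (cokernel_factor gC); have [t <-] := kernel_factor iK gC.1.
by rewrite mcompA hi comp0m.
Qed.

Lemma mono_kernel X Y Q (f : mor X Y) (q : mor Y Q) :
  is_mono f -> is_cokernel f q -> is_kernel q f.
Proof.
move=> fM qC; have [_ _ _ /(_ _ _ _ fM)[Z [g gK]] _] := CA.
apply: kernelI => // [|W h qh]; first exact: qC.1.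
apply: (kernel_factor gK); have [t <-] := cokernel_factor qC gK.1.
by rewrite -mcompA qh compm0.
Qed.

Lemma mono_short_exact X Y (f : mor X Y) :
  is_mono f -> exists Q (q : mor Y Q), short_exact f q.
Proof.
move=> fM; have [Q [q qC]] := has_cokernel f.
by exists Q, q; split=> //; apply: mono_kernel.
Qed.

Lemma epi_short_exact X Y (f : mor X Y) :
  is_epi f -> exists K (i : mor K X), short_exact i f.
Proof.
move=> fE; have [K [i iK]] := has_kernel f.
by exists K, i; split=> //; apply: epi_cokernel.
Qed.

Lemma mono_epi_iso X Y (f : mor X Y) : is_mono f -> is_epi f -> is_iso f.
Proof.
move=> fM fE; have [Q [q [qK _]]] := mono_short_exact fM.
have q0 : q = 0 by have /epiP := fE; apply; apply: qK.1.
have [|g fg] := kernel_factor (g := idm Y) qK; first by rewrite compm1.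
exists g; split=> //; apply: fM; by rewrite mcompA fg comp1m compm1.
Qed.

(** The image of [f] is represented by the kernel [K] of its cokernel. As a subobject of a simple
    object it is zero, which kills [f], or everything, which kills the cokernel. *)
Lemma simple_epi X S (f : mor X S) : simple_object S -> f <> 0 -> is_epi f.
Proof.
move=> [_ Ssimple] f0; have [Q [q qC]] := has_cokernel f.
have [K [i iK]] := has_kernel q; have [g ig] := kernel_factor iK qC.1.
have [K0|[j [_ ij]]] := Ssimple K i (kernel_mono iK).
  by case: f0; rewrite -ig ((K0 X).2 g) compm0.
apply/epiP=> W h /(cokernel_factor qC)[t <-].
suff -> : q = 0 by rewrite compm0.
by rewrite -(compm1 q) -ij mcompA iK.1 comp0m.
Qed.

Lemma simple_mono X S (f : mor S X) : simple_object S -> f <> 0 -> is_mono f.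
Proof.
move=> [_ Ssimple] f0; have [K [i iK]] := has_kernel f.
have [K0|[j [_ ij]]] := Ssimple K i (kernel_mono iK).
  by apply/monoP=> W h /(kernel_factor iK)[t <-]; rewrite ((K0 W).2 t) compm0.
by case: f0; rewrite -(compm1 f) -ij mcompA iK.1 comp0m.
Qed.

Lemma simple_iso S S' (f : mor S S') :
  simple_object S -> simple_object S' -> f <> 0 -> is_iso f.
Proof. by move=> sS sS' f0; apply: mono_epi_iso; [apply: simple_mono|apply: simple_epi]. Qed.

(** A substitute for length that is easy to transport: for modules it is the dimension over [k]. It
    has to drop when a nonzero subobject is divided out, but it need not count simple factors. *)
Definition additive_length (d : C -> nat) :=
  (forall X Y Z (f : mor X Y) (g : mor Y Z), short_exact f g -> d Y = (d X + d Z)%N) /\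
  forall X, d X = 0%N -> is_zero X.

(** Among the nonzero quotients of [X], one with the least value of [d] is simple: dividing it by a
    nonzero proper subobject would give a nonzero quotient with a smaller value. *)
Lemma has_simple_quotient d X : additive_length d -> ~ is_zero X ->
  exists S (q : mor X S), simple_object S /\ is_epi q.
Proof.
move=> [dE d0] X0.
pose Q n := `[< exists S (q : mor X S), [/\ d S = n, is_epi q & ~ is_zero S] >].
have exQ : exists n, Q n.
  by exists (d X); apply/asboolP; exists X, (idm X); split=> // W g h; rewrite !compm1.
have [n /asboolP[S [q [dS qE S0]]] minS] := ex_minnP exQ.
exists S, q; split=> //; split=> // Y i iM.
have [R [r irE]] := mono_short_exact iM.
have [Y0|Y0] := pselect (is_zero Y); [by left|right].
apply: mono_epi_iso => //.
have [R0|R0] := pselect (is_zero R).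
  apply/epiP=> W h /(cokernel_factor irE.2)[t <-].
  by rewrite ((R0 W).1 t) comp0m.
have : (n <= d R)%N.
  apply: minS; apply/asboolP; exists R, (r \oc q); split=> //.
  by apply: epi_comp => //; apply: cokernel_epi irE.2.
rewrite -dS (dE _ _ _ _ _ irE) -[X in (_ <= X)%N]add0n leq_add2r leqn0 => /eqP dY.
by case: Y0; apply: d0.
Qed.

Lemma has_composition_series d : additive_length d ->
  forall X, exists s, composition_series X s.
Proof.
move=> dP X; have [n] := ubnP (d X); elim: n X => // n IHn X dX.
have [X0|X0] := pselect (is_zero X); first by exists [::]; constructor.
have [S [q [sS qE]]] := has_simple_quotient dP X0.
have [Y [i iq]] := epi_short_exact qE.
have [|s Ys] := IHn Y; last by exists (S :: s); econstructor; eauto.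
move: dX; rewrite (dP.1 _ _ _ _ _ iq) ltnS => dX.
apply: leq_trans dX; rewrite -[X in (X < _)%N]addn0 ltn_add2l lt0n.
by apply/eqP=> /dP.2; case: sS.
Qed.

End AbelianCategories.

(** * Additivity and right exactness of linear functors *)

Section Functors.
Context {k : fieldType}.
Implicit Types B C D : lincat k.

Lemma fmor0 C D (F : functor C D) X Y : fmor F (0 : mor X Y) = 0.
Proof. exact: (linear_zero (@fmor_lin _ _ _ F X Y)). Qed.
Lemma fmorZ C D (F : functor C D) X Y a (f : mor X Y) : fmor F (a *: f) = a *: fmor F f.
Proof. exact: (linear_scale (@fmor_lin _ _ _ F X Y)). Qed.
Lemma fmor_sum C D (F : functor C D) X Y I (r : seq I) (P : pred I) (f : I -> mor X Y) :
  fmor F (\sum_(i <- r | P i) f i) = \sum_(i <- r | P i) fmor F (f i).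
Proof. exact: (linear_bigsum (@fmor_lin _ _ _ F X Y)). Qed.

Lemma bmor0r B C D (T : bifunctor B C D) X X' Y Y' (f : mor X X') :
  bmor T f (0 : mor Y Y') = 0.
Proof. exact: (linear_zero (@bmor_linr _ _ _ _ T _ _ _ _ f)). Qed.
Lemma bmorZl B C D (T : bifunctor B C D) X X' Y Y' a (f : mor X X') (g : mor Y Y') :
  bmor T (a *: f) g = a *: bmor T f g.
Proof. exact: (linear_scale (@bmor_linl _ _ _ _ T _ _ _ _ g)). Qed.
Lemma bmorZr B C D (T : bifunctor B C D) X X' Y Y' a (f : mor X X') (g : mor Y Y') :
  bmor T f (a *: g) = a *: bmor T f g.
Proof. exact: (linear_scale (@bmor_linr _ _ _ _ T _ _ _ _ f)). Qed.
Lemma bmor_suml B C D (T : bifunctor B C D) X X' Y Y' I (r : seq I) (P : pred I)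
    (f : I -> mor X X') (g : mor Y Y') :
  bmor T (\sum_(i <- r | P i) f i) g = \sum_(i <- r | P i) bmor T (f i) g.
Proof. exact: (linear_bigsum (@bmor_linl _ _ _ _ T _ _ _ _ g)). Qed.
Lemma bmor_sumr B C D (T : bifunctor B C D) X X' Y Y' I (r : seq I) (P : pred I)
    (f : mor X X') (g : I -> mor Y Y') :
  bmor T f (\sum_(i <- r | P i) g i) = \sum_(i <- r | P i) bmor T f (g i).
Proof. exact: (linear_bigsum (@bmor_linr _ _ _ _ T _ _ _ _ f)). Qed.

Lemma right_exact_epi C D (F : functor C D) X Y (f : mor X Y) :
  abelian_cat C -> right_exact F -> is_epi f -> is_epi (fmor F f).
Proof.
move=> CA FR /(epi_short_exact CA)[K [i [_ iC]]].
exact: cokernel_epi (FR _ _ _ _ _ iC).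
Qed.

Lemma right_exact_comp B C D (G : functor C D) (F : functor B C) :
  right_exact G -> right_exact F -> right_exact (comp_functor G F).
Proof. by move=> GR FR X Y Q f q /FR/GR. Qed.

End Functors.

(** * Projective covers and composition multiplicities *)

(** Left composition with [f] on the finite-dimensional space [mor S S] has an eigenvalue [a] with
    an eigenvector [w]. Then [f - a] kills a nonzero morphism, so it is not mono and must vanish. *)
Lemma schur (k : closedFieldType) (C : lincat k) (S : C) n :
  abelian_cat C -> simple_object S -> has_dim (mor S S) n ->
  forall f : mor S S, exists a, f = a *: idm S.
Proof.
move=> CA sS dimS f.
(* The characteristic polynomial below has degree [n], so it has a root only if [n] is positive. *)
have n_gt0 : (0 < n)%N.
  rewrite lt0n; apply/eqP=> n0; move: dimS; rewrite n0 => /has_dim0P S0.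
  by case: sS => /is_zeroP[].
have [e [c ecB]] := dimS; have [cL eS cE] := ecB.
pose M := \matrix_(a < n, b < n) c b (f \oc e a).
have [a] : exists a, root (char_poly M) a.
  by apply/closed_rootP; rewrite size_char_poly eqSS -lt0n.
rewrite -eigenvalue_root_char => /eigenvalueP[v vM v0]; exists a.
pose w := \sum_b v 0 b *: e b.
have w0 : w <> 0.
  move=> w0; case/eqP: v0; apply/rowP=> b; rewrite mxE.
  have <- : c b w = v 0 b by apply: basis_coord ecB.
  by rewrite w0 (linear_zero (cL b)).
have fw : (f - a *: idm S) \oc w = 0.
  rewrite compBl compZl comp1m; apply/eqP; rewrite subr_eq0; apply/eqP.
  rewrite comp_sumr.
  have fe b : f \oc e b = \sum_b' M b b' *: e b'.
    by rewrite (eS (f \oc e b)); apply: eq_bigr => b' _; rewrite mxE.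
  under eq_bigr => b _ do rewrite compZr fe scaler_sumr.
  rewrite exchange_big scaler_sumr; apply: eq_bigr => b _ /=.
  have /rowP/(_ b) := vM; rewrite !mxE => vMb.
  rewrite scalerA -vMb scaler_suml; apply: eq_bigr => b' _.
  by rewrite scalerA.
apply: contrapT => nf; apply: w0.
have fM : is_mono (f - a *: idm S).
  by apply: simple_mono => // /eqP; rewrite subr_eq0 => /eqP.
exact: (monoP _).1 fM _ _ fw.
Qed.

Section ProjectiveCovers.
Context {k : fieldType} {C : lincat k} (CA : abelian_cat C).
Implicit Types X Y Z W S P : C.

(** If [f] did not vanish on the kernel of [p], that kernel would already map onto [S], so together
    with the kernel [L] of [f] it would span [P]. Then [L] maps onto [X], essentiality makes [L] map
    onto [P], and [f] is zero. *)
Lemma essential_factor P X S (p : mor P X) (f : mor P S) :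
  essential_epi p -> simple_object S -> exists h, f = h \oc p.
Proof.
move=> [pE pess] sS; have [K [i [iK iC]]] := epi_short_exact CA pE.
suff /(cokernel_factor iC)[h <-] : f \oc i = 0 by exists h.
apply: contrapT => fi0; have fiE := simple_epi CA sS fi0.
have fE := epi_compl fiE; have [L [j [jK jC]]] := epi_short_exact CA fE.
have jE : is_epi j.
  apply: pess; apply/epiP=> W g gpj.
  have [|h hf] := cokernel_factor (g := g \oc p) jC; first by rewrite -mcompA.
  apply/(epiP p).1 => //; rewrite -hf; suff -> : h = 0 by rewrite comp0m.
  by apply/(epiP (f \oc i)).1 => //; rewrite mcompA hf -mcompA iK.1 compm0.
suff f0 : f = 0 by apply: fi0; rewrite f0 comp0m.
by apply/(epiP j).1 => //; apply: jK.1.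
Qed.

Section Representatives.
Context {n : nat} {V P : 'I_n -> C}.
Hypothesis (hV : simple_representatives V).
Hypothesis (hP : forall i, projective_cover (P i) (V i)).

(** The top quotient of a composition series is covered by some [P i], and projectivity lifts this
    cover to [X]; induction takes care of the restriction of [g] to the smaller term. The functor
    [T] is kept arbitrary so that the lemma applies to each variable of [box] in turn. *)
Lemma jointly_epi (D : lincat k) (T : functor C D) X s (Z : D) (g : mor (T X) Z) :
  right_exact T -> composition_series X s ->
  (forall i (p : mor (P i) X), g \oc fmor T p = 0) -> g = 0.
Proof.
move=> TR Xs; elim: Xs Z g => {X s} [X X0 Z g _|X Y S i q s [iK iC] sS _ IH Z g g0].
  by rewrite -(compm1 g) -fmor_id (is_zeroP X).1 // fmor0 compm0.
have [|h hq] := cokernel_factor (g := g) (TR _ _ _ _ _ iC).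
  by apply: IH => a p; rewrite -mcompA -fmor_comp; apply: g0.
rewrite -hq; suff -> : h = 0 by rewrite comp0m.
have [_ _ /(_ _ sS)[a [f [f' [f'f ff']]]]] := hV.
have [PP [p [pE _]]] := hP a.
have [r qr] := projective_cokernel (f' \oc p) PP iC.
have fpE : is_epi (fmor T (f' \oc p)).
  apply: right_exact_epi => //; apply: epi_comp => //.
  by apply: iso_epi; exists f.
apply/(epiP (fmor T (f' \oc p))).1 => //.
by rewrite -qr fmor_comp mcompA hq.
Qed.

Hypothesis (schurV : forall i (f : mor (V i) (V i)), exists a, f = a *: idm (V i)).

Lemma has_dim_cover i j : has_dim (mor (P i) (V j)) (i == j).
Proof.
have [sV Vinj _] := hV; have [PP [p pess]] := hP i.
case: eqP => [<- /=|ij /=].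
  apply: (@has_dim1 _ _ p) => [f|].
    have [h ->] := essential_factor f pess (sV i).
    by have [a ->] := schurV h; exists a; rewrite compZl comp1m.
  apply/eqP=> p0; case: (sV i) => V0 _; apply/V0/is_zeroP.
  by apply/(epiP p).1; [exact: pess.1|rewrite p0 compm0].
apply/has_dim0P => f; have [h ->] := essential_factor f pess (sV j).
have [->|/eqP h0] := eqVneq h 0; first by rewrite comp0m.
by case: ij; apply: Vinj; exists h; apply: simple_iso.
Qed.

Lemma has_dim_count X s j : composition_series X s ->
  has_dim (mor (P j) X) (count (fun S => `[< iso S (V j) >]) s).
Proof.
have [sV Vinj Vsurj] := hV; have [PP _] := hP j.
elim=> {X s} [X X0|X Y S i q s iq sS _ IH] /=.
  by apply/has_dim0P => f; apply: (X0 _).2.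
rewrite addnC; apply: has_dim_exact PP iq IH _.
have [a Sa] := Vsurj S sS; apply: iso_has_dim (iso_sym Sa) _.
suff -> : `[< iso S (V j) >] = (j == a) by apply: has_dim_cover.
apply/asboolP/eqP => [Sj|-> //]; apply: Vinj.
exact: iso_trans (iso_sym Sj) Sa.
Qed.

(** [mult] counts in a composition series chosen by [xget]; the formula for the dimension holds for
    every series, hence for the chosen one. The given [s] rules out the default value of [xget]. *)
Lemma mult_has_dim X s j : composition_series X s ->
  has_dim (mor (P j) X) (mult X (V j)).
Proof.
move=> Xs; rewrite /mult.
case: xgetP => [_ -> [s' Xs' ->]|/(_ (count (fun S => `[< iso S (V j) >]) s))[]].
  exact: has_dim_count.
by exists s.
Qed.

End Representatives.
End ProjectiveCovers.

(** * Computing in the Grothendieck group *)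

Section GrothendieckGroup.
Context {k : fieldType} {D : lincat k}.
Implicit Types (X Y Z : D) (a b c : formal_sum D).

Definition Gr_eq a b := exact_relations (fun W => b W - a W).

Lemma Gr_eq_sym a b : Gr_eq a b -> Gr_eq b a.
Proof.
move=> /(ExactSub (ExactZero D)); rewrite /Gr_eq.
by congr exact_relations; apply/funext => W; rewrite sub0r opprB.
Qed.

Lemma Gr_eq_trans b a c : Gr_eq a b -> Gr_eq b c -> Gr_eq a c.
Proof.
move=> /Gr_eq_sym ab bc; move: (ExactSub bc ab); rewrite /Gr_eq.
by congr exact_relations; apply/funext => W; rewrite opprB addrA subrK.
Qed.

Lemma Gr_eq_addl c a b : Gr_eq a b -> Gr_eq (fun W => c W + a W) (fun W => c W + b W).
Proof.
rewrite /Gr_eq; congr exact_relations; apply/funext => W.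
by rewrite opprD addrACA subrr add0r.
Qed.

Lemma Gr_eq_exact X Y Z (f : mor X Y) (g : mor Y Z) : short_exact f g ->
  Gr_eq (gen Y) (fun W => gen X W + gen Z W).
Proof.
move=> /ExactRelation fg; apply: Gr_eq_sym; move: fg; rewrite /Gr_eq.
by congr exact_relations; apply/funext => W; rewrite opprD addrA.
Qed.

(** The sequence of zero maps [X -> X -> X] is exact when [X] is zero, and its relation reads
    [gen X = gen X + gen X]. *)
Lemma Gr_eq_zero X : is_zero X -> Gr_eq (gen X) (fun=> 0).
Proof.
move=> X0; have X1 := (X0 X).1.
suff /Gr_eq_exact : short_exact (0 : mor X X) (0 : mor X X).
  rewrite /Gr_eq; move=> H; apply: Gr_eq_sym; move: H; rewrite /Gr_eq.
  by congr exact_relations; apply/funext => W; rewrite addrK subr0.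
split; split; rewrite ?comp0m // => Y h _; exists 0.
  by split=> [|h' _]; [rewrite comp0m ((X0 Y).2 h)|rewrite ((X0 Y).2 h')].
by split=> [|h' _]; [rewrite compm0 ((X0 Y).1 h)|rewrite ((X0 Y).1 h')].
Qed.

Lemma Gr_coset_eq a b : Gr_eq a b -> Gr_coset a = Gr_coset b.
Proof.
move=> ab; apply/funext => c; apply/propext; split; apply: Gr_eq_trans => //.
exact: Gr_eq_sym.
Qed.

(** The numbers [d t] play the part of a length: for nonzero [Z] some nonzero map [V t -> Z] exists,
    it is mono, and dividing by its image lowers [d t] by one and leaves the other values unchanged.
    Hence an induction on the sum of [d]. *)
Lemma Gr_decomposition (T : finType) (P V : T -> D) :
  abelian_cat D -> (forall t, projective (P t)) ->
  (forall t t', has_dim (mor (P t) (V t')) (t == t')) ->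
  (forall t Z, exists n, has_dim (mor (P t) Z) n) ->
  (forall Z W (f : mor Z W), (forall t (p : mor (P t) Z), f \oc p = 0) -> f = 0) ->
  (forall Z, ~ is_zero Z -> exists t (f : mor (V t) Z), f <> 0) ->
  forall Z (d : T -> nat), (forall t, has_dim (mor (P t) Z) (d t)) ->
  Gr_eq (gen Z) (fun W => \sum_t gen (V t) W *+ d t).
Proof.
move=> DA PP PV Pfd Pgen Vhom.
(* If the kernel of [f] were nonzero, some [P t'] would map nontrivially to [V t] through it.
   Orthogonality forces [t' = t], and since [mor (P t) (V t)] is a line, all its elements are
   multiples of that map. So [f] kills every map from a [P t1] and vanishes by generation. *)
have Vmono t Z (f : mor (V t) Z) : f <> 0 -> is_mono f.
  move=> f0; have [K [i iK]] := has_kernel DA f.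
  have iM := kernel_mono iK.
  have [i0|i0] := pselect (i = 0).
    by apply/monoP=> W g /(kernel_factor iK)[h <-]; rewrite i0 comp0m.
  have [t' [p ip]] : exists t' (p : mor (P t') K), i \oc p <> 0.
    apply: contrapT => H; apply: i0; apply: Pgen => t' p.
    by apply: contrapT => ip; apply: H; exists t', p.
  have tt' : t' = t.
    apply/eqP; apply: contrapT => /negP/negPf tt'; apply: ip.
    by have := PV t' t; rewrite tt' => /has_dim0P.
  case: f0; apply: Pgen => t1 q; rewrite {t'}tt' in p ip *.
  have [tt1|/negPf tt1] := eqVneq t1 t; last first.
    by have := PV t1 t; rewrite tt1 => /has_dim0P/(_ q) ->; rewrite compm0.
  rewrite {t1}tt1 in q *; have := PV t t; rewrite eqxx => /has_dim1P[e _ eP].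
  have [c qE] := eP q; have [c' ipE] := eP (i \oc p).
  have c'0 : c' != 0 by apply/eqP=> c'0; apply: ip; rewrite ipE c'0 scale0r.
  have -> : q = (c / c') *: (i \oc p) by rewrite ipE scalerA divfK.
  by rewrite compZr mcompA iK.1 comp0m scaler0.
move=> Z d; have [N] := ubnP (\sum_t d t)%N; elim: N Z d => // N IH Z d dN dP.
have [Z0|Z0] := pselect (is_zero Z).
  have -> : (fun W => \sum_t gen (V t) W *+ d t) = (fun=> 0).
    apply/funext => W; apply: big1 => t _.
    suff -> : d t = 0%N by rewrite mulr0n.
    by apply: has_dim_unique (dP t) _; apply/has_dim0P => f; apply: (Z0 _).2.
  exact: Gr_eq_zero.
have [t [f /Vmono f_mono]] := Vhom Z Z0.
have [Q [q fq]] := mono_short_exact DA f_mono.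
have [d' d'P] := choice (fun t => Pfd t Q).
have dE t' : d t' = ((t' == t) + d' t')%N.
  by apply: has_dim_unique (dP t') _; exact: has_dim_exact (PP t') fq (PV t' t) (d'P t').
apply: Gr_eq_trans (Gr_eq_exact fq) _.
have -> : (fun W => \sum_t gen (V t) W *+ d t)
        = (fun W => gen (V t) W + \sum_t gen (V t) W *+ d' t).
  apply/funext => W; rewrite (bigD1 t) //= [in RHS](bigD1 t) //=.
  rewrite dE eqxx mulrnDr mulr1n -addrA; congr (_ + (_ + _)).
  by apply: eq_bigr => t' /negPf tt'; rewrite dE tt'.
apply/Gr_eq_addl/IH => //; move: dN; rewrite ltnS; apply: leq_trans.
rewrite [X in (_ < X)%N](bigD1 t) //= (bigD1 t) //= dE eqxx ltnS leq_add2l.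
by apply: leq_sum => t' _; rewrite dE leq_addl.
Qed.

End GrothendieckGroup.

(** * The functor Hom(P, X) . Y on the Deligne product *)

Section Copowers.
Context {k : fieldType} {C : lincat k} (CA : abelian_cat C).
Implicit Types X Y Z W S P : C.

Lemma has_copower n Y : exists S (i : 'I_n -> mor Y S) (p : 'I_n -> mor S Y),
  (forall a b, p b \oc i a = (b == a)%:R *: idm Y) /\ \sum_a i a \oc p a = idm S.
Proof.
elim: n => [|n [S [i [p [pi ip]]]]].
  have [[Z Z0] _ _ _ _] := CA; exists Z, (fun=> 0), (fun=> 0).
  by split=> [[]//|]; rewrite big_ord0 (is_zeroP Z).1.
have [_ /(_ Y S)[T [i1 [i2 [p1 [p2 [pi1 pi2 pi12 pi21 ip12]]]]]] _ _ _] := CA.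
exists T, (fun a => if unlift ord0 a is Some b then i2 \oc i b else i1).
exists (fun a => if unlift ord0 a is Some b then p b \oc p2 else p1).
split=> [a b|].
  case: unliftP => [b' ->|->]; case: unliftP => [a' ->|->].
  - by rewrite -mcompA (mcompA p2) pi2 comp1m pi (inj_eq lift_inj).
  - by rewrite -mcompA pi21 compm0 scale0r.
  - by rewrite mcompA pi12 comp0m scale0r.
  - by rewrite eqxx scale1r.
rewrite big_ord_recl unlift_none -ip12; congr (_ + _).
transitivity (i2 \oc (\sum_a i a \oc p a) \oc p2); last by rewrite ip compm1.
rewrite comp_sumr comp_suml; apply: eq_bigr => a _.
by rewrite liftK !mcompA.
Qed.

(** This is exactness of [Hom(P, -)] in the middle, for an [f] that need not be mono. It reduces to
    [f'] being epi, where [f'] is [f] with target the kernel of [q]. *)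
Lemma cokernel_exact P X Y Q (f : mor X Y) (q : mor Y Q) (z : mor P Y) :
  projective P -> is_cokernel f q -> q \oc z = 0 -> exists y, f \oc y = z.
Proof.
move=> PP qC qz; have [K [i iK]] := has_kernel CA q.
have [f' f'E] := kernel_factor iK qC.1; have [z' <-] := kernel_factor iK qz.
suff f'_epi : is_epi f'.
  by have [y <-] := PP _ _ f' z' f'_epi; exists y; rewrite mcompA f'E.
(* As [t] kills [f'], the map [f] factors through the subobject [i \oc l]; the cokernel [r] of the
   latter then factors through [q], so it kills [i]. Hence [i] factors through [i \oc l], [l] has a
   section, and [t] is zero. *)
apply/epiP => W t tf'.
have [L [l lK]] := has_kernel CA t; have [f'' f''E] := kernel_factor lK tf'.
have ilM : is_mono (i \oc l).
  by move=> A g h; rewrite -!mcompA => /(kernel_mono iK)/(kernel_mono lK).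
have [R [r [rK _]]] := mono_short_exact CA ilM.
have [|r' r'E] := cokernel_factor (g := r) qC.
  by rewrite -f'E -f''E !mcompA -(mcompA r) rK.1 comp0m.
have [|v vE] := kernel_factor (g := i) rK; first by rewrite -r'E -mcompA iK.1 compm0.
have lv : l \oc v = idm K by apply: (kernel_mono iK); rewrite mcompA vE compm1.
by rewrite -(compm1 t) -lv mcompA lK.1 comp0m.
Qed.

End Copowers.

Section CoHom.
Context {k : fieldType} {C CC : lincat k} (CA : abelian_cat C).
Context {box : bifunctor C C CC} (hbox : deligne_product box).
Context {P : C} (PP : projective P).
Context {n : C -> nat} (e : forall X, 'I_(n X) -> mor P X).
Context (c : forall X, 'I_(n X) -> mor P X -> k).
Arguments e {X}. Arguments c {X}.
Hypothesis (ecB : forall X, basis (@e X) (@c X)).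

(** [Phi] extends [X, Y |-> Hom(P, X) . Y], the copower being presented by its
    universal family [u x : Y -> Hom(P, X) . Y] and the projections [pi a] dual to
    the chosen basis of [Hom(P, X)]. *)
Definition hom_copower (Phi : functor CC C)
    (u : forall X Y, mor P X -> mor Y (Phi (box X Y)))
    (pi : forall X Y, 'I_(n X) -> mor (Phi (box X Y)) Y) :=
  [/\ right_exact Phi,
      forall X Y, linear (u X Y),
      forall X X' Y Y' (f : mor X X') (g : mor Y Y') x,
        fmor Phi (bmor box f g) \oc u X Y x = u X' Y' (f \oc x) \oc g,
      forall X Y, \sum_a u X Y (e a) \oc pi X Y a = idm _
    & forall X Y x a, pi X Y a \oc u X Y x = c a x *: idm Y].

Section Construction.
Context {S : C -> C -> C} {i : forall X Y, 'I_(n X) -> mor Y (S X Y)}.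
Context {p : forall X Y, 'I_(n X) -> mor (S X Y) Y}.
Arguments i {X Y}. Arguments p {X Y}.
Hypothesis pi : forall X Y a b, @p X Y b \oc @i X Y a = (b == a)%:R *: idm Y.
Hypothesis ip : forall X Y, \sum_a @i X Y a \oc @p X Y a = idm (S X Y).

(** The component of the copower at an arbitrary element of [Hom(P, X)], extending the inclusions
    [i] linearly from the basis. Testing against all [u x] keeps the identities below free of
    coordinates. *)
Let u X Y (x : mor P X) : mor Y (S X Y) := \sum_a c a x *: i a.
Arguments u {X Y}.

Let uL X Y : linear (@u X Y).
Proof.
move=> r x y; rewrite /u scaler_sumr -big_split; apply: eq_bigr => a _ /=.
have [cL _ _] := ecB X.
by rewrite cL scalerDl scalerA.
Qed.

Let pu X Y x a : @p X Y a \oc u x = c a x *: idm Y.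
Proof.
rewrite /u comp_sumr (bigD1 a) //= compZr pi eqxx scale1r big1 ?addr0 //.
by move=> b /negPf ba; rewrite compZr pi eq_sym ba scale0r scaler0.
Qed.

Let ue X Y a : @u X Y (e a) = i a.
Proof.
have [_ _ cE] := ecB X; rewrite /u (bigD1 a) //= cE eqxx scale1r big1 ?addr0 //.
by move=> b /negPf ba; rewrite cE ba scale0r.
Qed.

Let u_ext X Y Z (h h' : mor (S X Y) Z) :
  (forall x, h \oc u x = h' \oc u x) -> h = h'.
Proof.
move=> hh; rewrite -(compm1 h) -(compm1 h') -ip !comp_sumr; apply: eq_bigr => a _.
by rewrite !mcompA -ue hh.
Qed.

Let cop_mor X X' Y Y' (f : mor X X') (g : mor Y Y') : mor (S X Y) (S X' Y') :=
  \sum_a u (f \oc e a) \oc g \oc p a.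

Let cop_morE X X' Y Y' (f : mor X X') (g : mor Y Y') x :
  cop_mor f g \oc u x = u (f \oc x) \oc g.
Proof.
rewrite (basis_linear_sum x (ecB X) (comp_linr f)) (linear_bigsum (@uL _ _)).
rewrite /cop_mor !comp_suml.
apply: eq_bigr => a _.
by rewrite -mcompA pu compZr compm1 (linear_scale (@uL _ _)) compZl.
Qed.

Let cop_bifunctor : bifunctor C C C.
Proof.
apply: (@Bifunctor _ _ _ _ S cop_mor).
- by move=> X Y; apply: u_ext => x; rewrite cop_morE !comp1m compm1.
- move=> X X' X'' Y Y' Y'' f' f g' g; apply: u_ext => x.
  by rewrite -mcompA !cop_morE (mcompA (cop_mor _ _)) cop_morE !mcompA.
- move=> X X' Y Y' g r f f' /=; apply: u_ext => x.
  by rewrite compDl compZl !cop_morE compDl compZl uL compDl compZl.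
- move=> X X' Y Y' f r g g' /=; apply: u_ext => x.
  by rewrite compDl compZl !cop_morE compDr compZr.
Defined.

Let cop_right_exact : biright_exact cop_bifunctor.
Proof.
split=> [Y|X] A B Q f q fqC; apply: cokernelI => /=.
- apply: u_ext => x; rewrite -mcompA !cop_morE (mcompA (cop_mor _ _)) cop_morE mcompA fqC.1.
  by rewrite comp0m !comp0m (linear_zero (@uL _ _)) !comp0m.
- apply/epiP => W h hq; apply: u_ext => x; rewrite comp0m.
  have [y <-] := projective_cokernel x PP fqC.
  by have := cop_morE q (idm Y) y; rewrite compm1 => <-; rewrite mcompA hq comp0m.
(* Exactness in [X]: the factorisation is built from lifts [l] along [q] of the basis of
   [Hom(P, Q)]. Two lifts of the same element differ by something that comes from [f], on which [g]
   vanishes. *)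
- move=> W g gf.
  have [l lE] := choice (fun a => projective_cokernel (e a) PP fqC).
  exists (\sum_a g \oc u (l a) \oc p a); apply: u_ext => x.
  rewrite -mcompA cop_morE compm1.
  pose x' := \sum_a c a (q \oc x) *: l a.
  have qx' : q \oc x' = q \oc x.
    have [_ eS _] := ecB Q; rewrite comp_sumr {2}(eS (q \oc x)); apply: eq_bigr => a _.
    by rewrite compZr lE.
  have [|y fy] := cokernel_exact (z := x - x') CA PP fqC.
    by rewrite compBr qx' subrr.
  have gu0 : g \oc u (x - x') = 0.
    rewrite -fy; have := cop_morE f (idm Y) y; rewrite compm1 => <-.
    by rewrite mcompA gf comp0m.
  have -> : g \oc u x = g \oc u x'.
    apply/eqP; rewrite -subr_eq0 -compBr -(linear_sub (@uL _ _)).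
    exact/eqP.
  rewrite (linear_bigsum (@uL _ _)) comp_suml comp_sumr; apply: eq_bigr => a _.
  by rewrite -mcompA pu compZr compm1 (linear_scale (@uL _ _)) compZr.
- apply: u_ext => x; rewrite -mcompA !cop_morE (mcompA (cop_mor _ _)) cop_morE !comp1m comp0m.
  by rewrite -mcompA fqC.1 compm0.
- apply/epiP => W h hq; apply: u_ext => x; rewrite comp0m.
  apply: (cokernel_epi fqC); rewrite comp0m -mcompA.
  have := cop_morE (idm X) q x; rewrite comp1m => <-.
  by rewrite mcompA hq comp0m.
(* Exactness in [Y]: the copower is a finite direct sum of copies of [Y], so each component of [g]
   factors through [q] separately. *)
- move=> W g gf.
  have /choice[h hE] a : exists h, h \oc q = g \oc u (e a).
    apply: (cokernel_factor fqC); rewrite -mcompA.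
    have := cop_morE (idm X) f (e a); rewrite comp1m => <-.
    by rewrite mcompA gf comp0m.
  exists (\sum_a h a \oc p a); apply: u_ext => x.
  have [_ eS _] := ecB X.
  rewrite -mcompA cop_morE comp1m mcompA comp_suml.
  under eq_bigr => a _ do rewrite -mcompA pu compZr compm1.
  rewrite comp_suml {2}(eS x) (linear_bigsum (@uL _ _)) comp_sumr.
  by apply: eq_bigr => a _; rewrite compZl hE (linear_scale (@uL _ _)) compZr.
Qed.

(** The universal property gives [Phi] on the [box X Y] only up to the isomorphism [eta], so the
    universal family and the projections are composed with its inverse and with it. *)
Lemma hom_copower_of_copowers : exists Phi u pi, @hom_copower Phi u pi.
Proof.
have [_ _ /(_ C CA)[/(_ _ cop_right_exact)[Phi [PhiR [eta [etaN etaI]]]] _]] := hbox.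
pose eta' X Y := sval (cid (etaI X Y)).
have eta'E X Y := svalP (cid (etaI X Y)).
exists Phi, (fun X Y x => eta' X Y \oc u x), (fun X Y a => p a \oc eta X Y).
split=> // [X Y a x y|X X' Y Y' f g x|X Y|X Y x a].
- by rewrite uL compDr compZr.
- have [/= e1 e2] := eta'E X' Y'; have [/= e3 e4] := eta'E X Y.
  rewrite -[LHS]comp1m -e1 -(mcompA (eta' _ _)) (mcompA (eta _ _)) -etaN.
  rewrite -(mcompA (bmor _ _ _)) (mcompA (eta _ _)) e4 comp1m /= cop_morE.
  by rewrite mcompA.
- have [/= e1 e2] := eta'E X Y.
  under eq_bigr => a _ do rewrite ue -mcompA (mcompA (i a)).
  by rewrite -comp_sumr -comp_suml ip comp1m.
- have [/= e1 e2] := eta'E X Y.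
  by rewrite -mcompA (mcompA (eta _ _)) e2 comp1m pu.
Qed.

End Construction.

Lemma has_hom_copower : exists Phi u pi, @hom_copower Phi u pi.
Proof.
have /choice[S] X : exists S : C -> C, forall Y, exists (i : 'I_(n X) -> mor Y (S Y))
    (p : 'I_(n X) -> mor (S Y) Y),
    (forall a b, p b \oc i a = (b == a)%:R *: idm Y) /\ \sum_a i a \oc p a = idm (S Y).
  by have [S SP] := choice (has_copower CA (n X)); exists S.
move=> SP.
pose i X Y := sval (cid (SP X Y)).
pose p X Y := sval (cid (svalP (cid (SP X Y)))).
have ipP X Y := svalP (cid (svalP (cid (SP X Y)))).
by apply: (@hom_copower_of_copowers S i p) => X Y; have [] := ipP X Y.
Qed.
End CoHom.

(** * Its left adjoint *)

Section DeligneExtension.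
Context {k : fieldType} {B C D A : lincat k}.
Context {box : bifunctor B C D} (hbox : deligne_product box) (AA : abelian_cat A).
Context {G H : functor D A} (GR : right_exact G) (HR : right_exact H).

Lemma deligne_extension (theta : forall X Y, mor (G (box X Y)) (H (box X Y))) :
  (forall X X' Y Y' (f : mor X X') (g : mor Y Y'),
     fmor H (bmor box f g) \oc theta X Y = theta X' Y' \oc fmor G (bmor box f g)) ->
  exists eta : forall Z, mor (G Z) (H Z),
    natural eta /\ forall X Y, eta (box X Y) = theta X Y.
Proof.
move=> thetaN; have [_ _ /(_ A AA)[_ /(_ _ _ GR HR theta thetaN)[eta [etaP _]]]] := hbox.
by exists eta.
Qed.

(** The uniqueness half of full faithfulness; it reduces triangle identities, and the vanishing of a
    right exact functor, to the objects [box X Y]. *)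
Lemma deligne_ext (s t : forall Z, mor (G Z) (H Z)) : natural s -> natural t ->
  (forall X Y, s (box X Y) = t (box X Y)) -> forall Z, s Z = t Z.
Proof.
move=> sN tN st Z.
have [_ _ /(_ A AA)[_ /(_ _ _ GR HR (fun X Y => s (box X Y))) uniq_s]] := hbox.
have [|r [_ rU]] := uniq_s; first by move=> X X' Y Y' f g; apply: sN.
have <- := rU s (conj sN (fun _ _ => erefl)).
by have <- := rU t (conj tN (fun X Y => esym (st X Y))).
Qed.

End DeligneExtension.

Section LeftAdjoint.
Context {k : fieldType} {C CC : lincat k} (CA : abelian_cat C).
Context {box : bifunctor C C CC} (hbox : deligne_product box).
Context {P : C} {n : C -> nat} {e : forall X, 'I_(n X) -> mor P X}.
Context {c : forall X, 'I_(n X) -> mor P X -> k}.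
Arguments e {X}. Arguments c {X}.
Hypothesis (ecB : forall X, basis (@e X) (@c X)).
Context {Phi : functor CC C} {u : forall X Y, mor P X -> mor Y (Phi (box X Y))}.
Context {pr : forall X Y, 'I_(n X) -> mor (Phi (box X Y)) Y}.
Arguments u {X Y}. Arguments pr {X Y}.
Hypothesis (PhiP : hom_copower (@e) (@c) (@u) (@pr)).

(** Unit of the adjunction between [box P -] and [Phi]; by naturality it determines the whole family
    [u]. *)
Definition copower_unit Y : mor Y (Phi (box P Y)) := u (idm P).
Local Notation eta := copower_unit.

Lemma copower_unit_nat Y Y' (g : mor Y Y') :
  fmor Phi (bmor box (idm P) g) \oc eta Y = eta Y' \oc g.
Proof. by have [_ _ uN _ _] := PhiP; rewrite uN comp1m. Qed.

Lemma copower_unitE X Y (x : mor P X) :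
  u x = fmor Phi (bmor box x (idm Y)) \oc eta Y.
Proof. by have [_ _ uN _ _] := PhiP; rewrite uN !compm1. Qed.

Lemma copower_ext X Y Z (h h' : mor (Phi (box X Y)) Z) :
  (forall x, h \oc u x = h' \oc u x) -> h = h'.
Proof.
have [_ _ _ upi _] := PhiP => hh.
rewrite -(compm1 h) -(compm1 h') -upi !comp_sumr; apply: eq_bigr => a _.
by rewrite !mcompA hh.
Qed.

Lemma copower_box_ext X Y Q Z (h h' : mor (box Q (Phi (box X Y))) Z) :
  (forall x, h \oc bmor box (idm Q) (u x) = h' \oc bmor box (idm Q) (u x)) -> h = h'.
Proof.
have [_ _ _ upi _] := PhiP => hh.
rewrite -(compm1 h) -(compm1 h') -bmor_id -upi bmor_sumr !comp_sumr.
apply: eq_bigr => a _.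
by rewrite -(comp1m (idm Q)) bmor_comp !mcompA hh.
Qed.

(** On [box X Y] the counit is the evaluation [theta]: on the component of [box P (Hom(P, X) . Y)]
    at [x] it is [x] in the first variable, as the second clause records. The last two clauses are
    the triangle identities. *)
Lemma copower_adjunction : exists eps : forall Z, mor (box P (Phi Z)) Z,
  [/\ forall Z Z' (f : mor Z Z'), f \oc eps Z = eps Z' \oc bmor box (idm P) (fmor Phi f),
      forall X Y (x : mor P X),
        eps (box X Y) \oc bmor box (idm P) (u x) = bmor box x (idm Y),
      forall Y, eps (box P Y) \oc bmor box (idm P) (eta Y) = idm _
    & forall Z, fmor Phi (eps Z) \oc eta (Phi Z) = idm _].
Proof.
have [PhiR uL uN upi piu] := PhiP; have [CCA [boxl boxr] _] := hbox.
pose theta X Y : mor (box P (Phi (box X Y))) (box X Y) :=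
  \sum_a bmor box (e a) (pr a).
have thetau X Y (x : mor P X) : theta X Y \oc bmor box (idm P) (u x) = bmor box x (idm Y).
  have [_ eS _] := ecB X.
  rewrite comp_suml {2}(eS x) bmor_suml; apply: eq_bigr => a _.
  by rewrite -bmor_comp piu compm1 bmorZr bmorZl.
have R1 := right_exact_comp (boxr P) PhiR.
have R2 : right_exact (id_functor CC) by [].
have [|eps [epsN epsE]] := deligne_extension hbox CCA R1 R2 (theta := theta).
  move=> X X' Y Y' f g; apply: copower_box_ext => x /=.
  rewrite -mcompA thetau -bmor_comp compm1 -mcompA -bmor_comp comp1m uN.
  by rewrite -[in RHS](comp1m (idm P)) bmor_comp mcompA thetau -bmor_comp compm1 comp1m.
exists eps; split=> [Z Z' f|X Y x|Y|]; first exact: epsN.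
- by rewrite epsE thetau.
- by rewrite epsE thetau bmor_id.
apply: (deligne_ext hbox CA PhiR PhiR) => [Z Z' f|Z Z' f|X Y].
- rewrite mcompA -fmor_comp (epsN _ _ f) fmor_comp -!mcompA; congr (_ \oc _).
  exact: copower_unit_nat.
- by rewrite comp1m compm1.
- rewrite epsE fmor_sum comp_suml -upi; apply: eq_bigr => a _.
  by rewrite uN compm1.
Qed.

End LeftAdjoint.

(** * Mates under duality *)

Section MonoidalCoherence.
Context {k : fieldType} {C : lincat k} (M : monoidal C).
Implicit Types X Y Z W D : C.
Local Notation T := (tens M).
Local Notation "f ** g" := (bmor T f g) (at level 39, left associativity).
Local Notation I := (unit_ob M).

(** Composites are kept associated to the left, so an equation between two adjacent factors has to
    be applied behind a prefix [h]. *)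
Let oc_eq X Y Z W (g : mor Y Z) (f : mor X Y) (r : mor X Z) (h : mor Z W) :
  g \oc f = r -> h \oc g \oc f = h \oc r.
Proof. by move=> <-; rewrite mcompA. Qed.

Lemma tensDl X Y Z W (f : mor X Y) (g : mor Y Z) :
  (g \oc f) ** idm W = g ** idm W \oc f ** idm W.
Proof. by rewrite -bmor_comp compm1. Qed.

Lemma tensDr X Y Z W (f : mor X Y) (g : mor Y Z) :
  idm W ** (g \oc f) = idm W ** g \oc idm W ** f.
Proof. by rewrite -bmor_comp compm1. Qed.

Lemma tens_swap X Y Z W (f : mor X Y) (g : mor Z W) :
  f ** idm W \oc idm X ** g = idm Y ** g \oc f ** idm Z.
Proof. by rewrite -!bmor_comp !compm1 !comp1m. Qed.

Lemma assoc'_nat X X' Y Y' Z Z' (f : mor X X') (g : mor Y Y') (h : mor Z Z') :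
  assoc' M X' Y' Z' \oc f ** (g ** h) = f ** g ** h \oc assoc' M X Y Z.
Proof.
rewrite -[LHS]compm1 -(assoc'K M X Y Z) mcompA (oc_eq _ (assoc_nat M f g h)).
by rewrite mcompA assocK comp1m.
Qed.

Lemma lunit'_nat X X' (f : mor X X') : idm I ** f \oc lunit' M X = lunit' M X' \oc f.
Proof.
rewrite -[LHS]comp1m -(lunitK M X') -mcompA (mcompA (lunit M X')) -lunit_nat.
by rewrite -mcompA lunit'K compm1.
Qed.

Lemma runit'_nat X X' (f : mor X X') : f ** idm I \oc runit' M X = runit' M X' \oc f.
Proof.
rewrite -[LHS]comp1m -(runitK M X') -mcompA (mcompA (runit M X')) -runit_nat.
by rewrite -mcompA runit'K compm1.
Qed.

Lemma tens_unit_inj X Y (f g : mor X Y) : idm I ** f = idm I ** g -> f = g.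
Proof.
move=> fg; rewrite -[f]compm1 -[g]compm1 -(lunit'K M X) !mcompA.
by rewrite !lunit_nat fg.
Qed.

Lemma unit_tens_inj X Y (f g : mor X Y) : f ** idm I = g ** idm I -> f = g.
Proof.
move=> fg; rewrite -[f]compm1 -[g]compm1 -(runit'K M X) !mcompA.
by rewrite !runit_nat fg.
Qed.

Lemma assoc_iso X Y Z : is_iso (assoc M X Y Z).
Proof. by exists (assoc' M X Y Z); rewrite assocK assoc'K. Qed.

Lemma tens_iso_l X Y W (f : mor X Y) : is_iso f -> is_iso (f ** idm W).
Proof. by move=> [g [gf fg]]; exists (g ** idm W); rewrite -!tensDl gf fg !bmor_id. Qed.

(** Kelly's unit coherences follow from the pentagon and the triangle. *)
Lemma lunit_tens X Y : lunit M (T X Y) \oc assoc M I X Y = lunit M X ** idm Y.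
Proof.
apply: tens_unit_inj; rewrite tensDr.
apply: (iso_epi (assoc_iso I (T I X) Y)).
apply: (iso_epi (tens_iso_l Y (assoc_iso I I X))).
rewrite -!mcompA (mcompA (idm I ** assoc M I X Y)) -pentagon !mcompA triangle.
rewrite assoc_nat -(mcompA (assoc M I X Y)) -tensDl triangle.
by rewrite -(bmor_id T X Y) assoc_nat.
Qed.

Lemma runit_tens X Y : idm X ** runit M Y \oc assoc M X Y I = runit M (T X Y).
Proof.
apply: unit_tens_inj; rewrite tensDl.
apply: (iso_mono (assoc_iso X Y I)).
rewrite mcompA -assoc_nat -triangle tensDr -!mcompA.
rewrite (mcompA (idm X ** assoc M Y I I)) -pentagon mcompA assoc_nat bmor_id.
by rewrite -mcompA triangle.
Qed.

Lemma lunit_unit : lunit M I = runit M I.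
Proof.
apply: unit_tens_inj; rewrite -lunit_tens -triangle; congr (_ \oc _).
have lI : is_iso (lunit M I) by exists (lunit' M I); rewrite lunitK lunit'K.
apply: (iso_mono lI).
by rewrite lunit_nat.
Qed.

Lemma pentagon_l X Y Z W :
  assoc' M X Y (T Z W) \oc idm X ** assoc M Y Z W
  = assoc M (T X Y) Z W \oc assoc' M X Y Z ** idm W \oc assoc' M X (T Y Z) W.
Proof.
apply: (iso_epi (assoc_iso X (T Y Z) W)); rewrite -[RHS]mcompA assocK compm1.
apply: (iso_epi (tens_iso_l W (assoc_iso X Y Z))).
rewrite -[RHS]mcompA -tensDl assocK bmor_id compm1 -!mcompA.
by rewrite (mcompA (idm X ** _)) -pentagon mcompA assocK comp1m.
Qed.

Lemma pentagon_r X Y Z W :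
  assoc M (T X Y) Z W \oc assoc' M X Y Z ** idm W
  = assoc' M X Y (T Z W) \oc idm X ** assoc M Y Z W \oc assoc M X (T Y Z) W.
Proof. by rewrite pentagon_l -mcompA assocK compm1. Qed.

Section Duality.
Context {D X : C} (d : duality M D X).

(** The two bijections [Hom(D Y, 1) = Hom(Y, X)] and [Hom(Y X, 1) = Hom(Y, D)] of a
    duality, both inverse to composition with the evaluation. *)
Definition mate_r Y (f : mor (T D Y) I) : mor Y X :=
  runit M X \oc idm X ** f \oc assoc M X D Y \oc coev d ** idm Y \oc lunit' M Y.

Definition mate_l Y (f : mor (T Y X) I) : mor Y D :=
  lunit M D \oc f ** idm D \oc assoc' M Y X D \oc idm Y ** coev d \oc runit' M Y.

(** Naturality, the pentagon and the unit coherences pull [f] to the front; what remains behind it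
    is [zigzag_l] tensored with [Y] on the right. *)
Lemma mate_rK Y (f : mor (T D Y) I) : ev d \oc idm D ** mate_r f = f.
Proof.
have evr : ev d \oc idm D ** runit M X = runit M I \oc ev d ** idm I \oc assoc' M D X I.
  rewrite -[in LHS](compm1 (idm D ** _)) -(assoc'K M D X I) !mcompA.
  by rewrite (oc_eq _ (runit_tens _ _)) runit_nat.
have dzz : assoc' M D I Y \oc idm D ** lunit' M Y = runit' M D ** idm Y.
  apply: (iso_mono (assoc_iso D I Y)); rewrite mcompA assoc'K comp1m.
  have lI : is_iso (idm D ** lunit M Y).
    exists (idm D ** lunit' M Y).
    by rewrite -!tensDr lunitK lunit'K !bmor_id.
  apply: (iso_mono lI).
  by rewrite mcompA triangle -tensDl -tensDr runit'K lunit'K !bmor_id.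
rewrite /mate_r !tensDr !mcompA evr (oc_eq _ (assoc'_nat _ _ _)) bmor_id !mcompA.
rewrite (oc_eq _ (tens_swap _ _)) mcompA -lunit_unit -lunit_nat.
rewrite (oc_eq _ (pentagon_l _ _ _ _)) !mcompA.
rewrite -(bmor_id T D Y) (oc_eq _ (assoc_nat M _ _ _)) !mcompA.
rewrite (oc_eq _ (lunit_tens _ _)) (oc_eq _ (assoc'_nat _ _ _)) !mcompA.
rewrite (oc_eq _ dzz) -!(mcompA f) -!tensDl.
by rewrite zigzag_l bmor_id compm1.
Qed.

(** Mirror image of [mate_rK]: what remains behind [f] is [zigzag_r] tensored with [Y] on the
    left. *)
Lemma mate_lK Y (f : mor (T Y X) I) : ev d \oc mate_l f ** idm X = f.
Proof.
have evl : ev d \oc lunit M D ** idm X = lunit M I \oc idm I ** ev d \oc assoc M I D X.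
  by rewrite -lunit_tens mcompA lunit_nat.
have dzz : assoc M Y I X \oc runit' M Y ** idm X = idm Y ** lunit' M X.
  have lI : is_iso (idm Y ** lunit M X).
    exists (idm Y ** lunit' M X).
    by rewrite -!tensDr lunitK lunit'K !bmor_id.
  apply: (iso_mono lI).
  by rewrite mcompA triangle -tensDl -tensDr runit'K lunit'K !bmor_id.
rewrite /mate_l !tensDl !mcompA evl (oc_eq _ (esym (assoc_nat M _ _ _))) bmor_id.
rewrite !mcompA (oc_eq _ (esym (tens_swap _ _))) mcompA lunit_unit -runit_nat.
rewrite (oc_eq _ (pentagon_r _ _ _ _)) !mcompA.
rewrite -(bmor_id T Y X) (oc_eq _ (esym (assoc'_nat _ _ _))) !mcompA -runit_tens.
rewrite !mcompA (oc_eq _ (assoc'K _ _ _ _)) compm1 (oc_eq _ (esym (assoc_nat M _ _ _))).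
rewrite !mcompA (oc_eq _ dzz) -!(mcompA f) -!tensDr.
by rewrite zigzag_r bmor_id compm1.
Qed.

Lemma mate_rE Y (h : mor Y X) : mate_r (ev d \oc idm D ** h) = h.
Proof.
rewrite /mate_r tensDr !mcompA (oc_eq _ (assoc_nat M _ _ _)) bmor_id !mcompA.
rewrite (oc_eq _ (esym (tens_swap _ _))) !mcompA (oc_eq _ (lunit'_nat _)) !mcompA.
by rewrite zigzag_r comp1m.
Qed.

Lemma mate_lE Y (h : mor Y D) : mate_l (ev d \oc h ** idm X) = h.
Proof.
rewrite /mate_l tensDl !mcompA (oc_eq _ (esym (assoc'_nat _ _ _))) bmor_id !mcompA.
rewrite (oc_eq _ (tens_swap _ _)) !mcompA (oc_eq _ (runit'_nat _)) !mcompA.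
by rewrite zigzag_l comp1m.
Qed.

End Duality.
End MonoidalCoherence.

(** * The right dual as a contravariant functor *)

Section RightDuals.
Context {k : fieldType} {C : finTensorCat k}.
Implicit Types X Y Z P : C.
Local Notation M := (ftc_monoidal C).
Local Notation T := (tens M).

(** Read as a mate, the transpose is characterised by its pairing with the evaluation; its
    functoriality then follows from the uniqueness of mates. *)
Lemma rdual_morE X Y (f : mor X Y) :
  rdual_mor f = mate_r (rdualP X) (ev (rdualP Y) \oc bmor T f (idm (rdual Y))).
Proof.
rewrite /rdual_mor /mate_r tensDr !mcompA; congr (_ \oc _ \oc _).
by rewrite -!mcompA; congr (_ \oc (_ \oc _)); rewrite assoc_nat.
Qed.

Lemma ev_rdual_mor X Y (f : mor X Y) :
  ev (rdualP X) \oc bmor T (idm X) (rdual_mor f)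
  = ev (rdualP Y) \oc bmor T f (idm (rdual Y)).
Proof. by rewrite rdual_morE mate_rK. Qed.

Lemma rdual_mor_lin X Y : linear (@rdual_mor k C X Y).
Proof.
move=> a f g; rewrite /rdual_mor !(bmor_linr, bmor_linl).
by rewrite !(compDr, compDl, compZr, compZl).
Qed.

Lemma ev_inj X Y (h h' : mor Y (rdual X)) :
  ev (rdualP X) \oc bmor T (idm X) h = ev (rdualP X) \oc bmor T (idm X) h' -> h = h'.
Proof. by move=> hh; rewrite -(mate_rE (rdualP X) h) hh mate_rE. Qed.

Lemma rdual_mor_id X : rdual_mor (idm X) = idm (rdual X).
Proof. by apply: ev_inj; rewrite ev_rdual_mor. Qed.

Lemma rdual_mor_comp X Y Z (g : mor Y Z) (f : mor X Y) :
  rdual_mor (g \oc f) = rdual_mor f \oc rdual_mor g.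
Proof.
apply: ev_inj; rewrite ev_rdual_mor tensDr mcompA ev_rdual_mor -mcompA tens_swap.
by rewrite mcompA ev_rdual_mor -mcompA -tensDl.
Qed.

(** Maps from [X] to the left dual of [P] and maps from [P] to the right dual of [X] both correspond
    to maps from the tensor product of [X] and [P] to the unit. The map [r] is what the identity of
    [ldual P] corresponds to, the canonical comparison of two right duals of [ldual P]. *)
Lemma rdual_ldual P : exists r : mor P (rdual (ldual P)),
  forall X (p : mor P (rdual X)), exists! f : mor X (ldual P), rdual_mor f \oc r = p.
Proof.
exists (mate_r (rdualP (ldual P)) (ev (ldualP P))) => X p.
set r := mate_r _ _.
have evr f : ev (rdualP X) \oc bmor T (idm X) (rdual_mor f \oc r)
    = ev (ldualP P) \oc bmor T f (idm P).
  rewrite tensDr mcompA ev_rdual_mor -mcompA tens_swap mcompA.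
  by rewrite mate_rK.
exists (mate_l (ldualP P) (ev (rdualP X) \oc bmor T (idm X) p)); split.
  by apply: ev_inj; rewrite evr mate_lK.
by move=> f <-; rewrite evr mate_lE.
Qed.

End RightDuals.

(** * Its right adjoint and the coend *)

(** [I], with the linear form [tau] on [Hom(P, I)], represents the functor
    [X |-> Hom(P, X)^*]. *)
Definition nakayama (k : fieldType) (C : lincat k) (P I : C) (tau : mor P I -> k) :=
  linear (tau : mor P I -> k^o) /\
  forall X (lam : mor P X -> k), linear (lam : mor P X -> k^o) ->
  exists! t : mor X I, forall p, tau (t \oc p) = lam p.

Section CoendCopower.
Context {k : fieldType} {C : finTensorCat k} {CC : lincat k}.
Hypothesis (CA : abelian_cat C).
Context {box : bifunctor C C CC} (hbox : deligne_product box).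
Context {P : C} {n : C -> nat} {e : forall X, 'I_(n X) -> mor P X}.
Context {c : forall X, 'I_(n X) -> mor P X -> k}.
Arguments e {X}. Arguments c {X}.
Hypothesis (ecB : forall X, basis (@e X) (@c X)).
Context {Phi : functor CC C} {u : forall X Y, mor P X -> mor Y (Phi (box X Y))}.
Context {pr : forall X Y, 'I_(n X) -> mor (Phi (box X Y)) Y}.
Arguments u {X Y}. Arguments pr {X Y}.
Hypothesis (PhiP : hom_copower (@e) (@c) (@u) (@pr)).
Context {I : C} {tau : mor P I -> k} (tauP : nakayama tau).

(** Under the pairing of [t] and [p] into [tau (t \oc p)], the [E a] are the basis of [Hom(X, I)]
    dual to [e]; each one represents a coordinate form. *)
Let has_dual_basis X : exists E : 'I_(n X) -> mor X I,
  forall a p, tau (E a \oc p) = c a p.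
Proof.
have [_ tauU] := tauP; have [cL _ _] := ecB X.
have /choice[E EP] a : exists t : mor X I, forall p, tau (t \oc p) = c a p.
  by have [t [tE _]] := tauU _ _ (cL a); exists t.
by exists E.
Qed.

Let E X : 'I_(n X) -> mor X I := sval (cid (has_dual_basis X)).
Arguments E {X}.

Let tauE X a (p : mor P X) : tau (E a \oc p) = c a p.
Proof. exact: (svalP (cid (has_dual_basis X))). Qed.

Let dual_expand X (t : mor X I) : t = \sum_a tau (t \oc e a) *: E a.
Proof.
have [tauL tauU] := tauP; have [_ eS _] := ecB X.
have tL : linear (fun p => tau (t \oc p) : k^o).
  by move=> x p q; rewrite comp_linr tauL.
have [r [_ rU]] := tauU _ _ tL.
transitivity r; [exact/esym/rU|apply: rU => p].
rewrite comp_suml (linear_bigsum tauL) (basis_linear_sum p (ecB X) tL).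
apply: eq_bigr => a _; rewrite compZl (linear_scale tauL) tauE.
exact: (mulrC (tau (t \oc e a)) (c a p)).
Qed.

(** Unit of the adjunction between [Phi] and [box I -]: the canonical tensor of a space with its
    dual, where the dual of [Hom(P, X)] is read as [Hom(X, I)]. Its naturality expresses
    independence of the basis. *)
Let beta_box X Y : mor (box X Y) (box I (Phi (box X Y))) :=
  \sum_a bmor box (E a) (u (e a)).

Let has_beta : exists beta : forall Z, mor Z (box I (Phi Z)),
  (forall Z Z' (f : mor Z Z'),
     bmor box (idm I) (fmor Phi f) \oc beta Z = beta Z' \oc f) /\
  forall X Y, beta (box X Y) = beta_box X Y.
Proof.
have [PhiR uL uN _ _] := PhiP; have [CCA [_ boxr] _] := hbox.
have R2 := right_exact_comp (boxr I) PhiR.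
have R1 : right_exact (id_functor CC) by [].
have [|beta [betaN betaE]] := deligne_extension hbox CCA R1 R2 (theta := beta_box).
  move=> X X' Y Y' f g /=; rewrite comp_sumr comp_suml.
  under eq_bigr => a _ do rewrite -bmor_comp comp1m uN.
  under [RHS]eq_bigr => b _ do rewrite -bmor_comp (dual_expand (_ \oc f)) bmor_suml.
  rewrite exchange_big; apply: eq_bigr => a _ /=.
  rewrite (basis_linear_sum _ (ecB X') (@uL X' Y')) comp_suml bmor_sumr.
  by apply: eq_bigr => b _; rewrite -mcompA tauE compZl bmorZl bmorZr.
by exists beta; split=> // Z Z' f; apply: betaN.
Qed.

(** Counit of the same adjunction: [tau] contracts the factor [Hom(P, I)]. *)
Let alpha W : mor (Phi (box I W)) W := \sum_a tau (e a) *: pr a.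

Let alphau W (x : mor P I) : alpha W \oc u x = tau x *: idm W.
Proof.
have [tauL _] := tauP; have [_ _ _ _ pru] := PhiP.
rewrite comp_suml (basis_linear_sum x (ecB I) tauL) scaler_suml.
by apply: eq_bigr => a _; rewrite compZl pru scalerA mulrC.
Qed.

Let alpha_nat W W' (g : mor W W') :
  alpha W' \oc fmor Phi (bmor box (idm I) g) = g \oc alpha W.
Proof.
have [_ _ uN _ _] := PhiP; apply: (copower_ext PhiP) => x.
by rewrite -mcompA uN comp1m mcompA alphau -mcompA alphau compZl compZr comp1m compm1.
Qed.

Let alpha_beta (beta : forall Z, mor Z (box I (Phi Z))) :
  (forall Z Z' (f : mor Z Z'),
     bmor box (idm I) (fmor Phi f) \oc beta Z = beta Z' \oc f) ->
  (forall X Y, beta (box X Y) = beta_box X Y) ->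
  forall Z, alpha (Phi Z) \oc fmor Phi (beta Z) = idm (Phi Z).
Proof.
move=> betaN betaE; have [PhiR uL uN _ _] := PhiP.
apply: (deligne_ext hbox CA PhiR PhiR) => [Z Z' f|Z Z' f|X Y].
- by rewrite mcompA -alpha_nat -!mcompA -!fmor_comp betaN.
- by rewrite comp1m compm1.
apply: (copower_ext PhiP) => x; rewrite betaE fmor_sum comp_sumr comp_suml comp1m.
rewrite [RHS](basis_linear_sum x (ecB X) (@uL X Y)); apply: eq_bigr => a _.
by rewrite -mcompA uN mcompA alphau tauE compZl comp1m.
Qed.

Context {Q : C} {r : mor P (rdual Q)}.
Hypothesis (rP : forall X (p : mor P (rdual X)),
  exists! f : mor X Q, rdual_mor f \oc r = p).
Context {F : functor C C} {K : CC} {iota : forall X : C, mor (box (rdual X) (F X)) K}.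
Hypothesis (hK : is_coend iota).

Let transpose X (p : mor P (rdual X)) : mor X Q := sval (cid (rP p)).

Let transposeK X (p : mor P (rdual X)) : rdual_mor (transpose p) \oc r = p.
Proof. exact: (svalP (cid (rP p))).1. Qed.

Let transposeE X (f : mor X Q) : transpose (rdual_mor f \oc r) = f.
Proof. exact: (svalP (cid (rP (rdual_mor f \oc r)))).2. Qed.

Let transpose_lin X : linear (@transpose X).
Proof.
move=> a p q; rewrite -[RHS]transposeE rdual_mor_lin compDl compZl.
by rewrite !transposeK.
Qed.

(** [Phi K] is the coend of [Hom(P, *X) . F X = Hom(X, Q) . F X], which is [F Q] by
    Yoneda: [j] is the component of the universal family at the identity of [Q], [beta]
    shows that it is epi and [alpha] yields a retraction. *)
Lemma coend_copower : iso (F Q) (Phi K).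
Proof.
have [PhiR uL uN _ _] := PhiP; have [iotaD iotaU] := hK.
have [beta [betaN betaE]] := has_beta.
pose eta Y := copower_unit (u := @u) Y.
pose j := fmor Phi (iota Q \oc bmor box r (idm _)) \oc eta (F Q).
(* Dinaturality of [iota] at [f] moves everything to the index [Q]: each component of [Phi (iota X)]
   is the single map [j] after a value of [F]. *)
have jF X (f : mor X Q) : fmor Phi (iota X) \oc u (rdual_mor f \oc r) = j \oc fmor F f.
  rewrite (copower_unitE PhiP) mcompA -fmor_comp.
  rewrite -{1}(comp1m (idm (F X))) bmor_comp mcompA iotaD -mcompA -bmor_comp.
  rewrite comp1m compm1 -{1}(compm1 r) -{1}(comp1m (fmor F f)) bmor_comp mcompA.
  rewrite fmor_comp -mcompA (copower_unit_nat PhiP) mcompA.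
  by [].
have jE : is_epi j.
  apply/epiP => W t tj.
  (* This is the transpose of [t] across the adjunction between [Phi] and [box I -]. Being a map out
     of [K], it is determined by its composites with the [iota X]. *)
  suff that0 : bmor box (idm I) t \oc beta K = 0.
    rewrite -(compm1 t) -(alpha_beta betaN betaE) mcompA -alpha_nat -mcompA -fmor_comp.
    by rewrite that0 fmor0 compm0.
  have zeroD : dinatural (F := F) (fun X => 0 : mor (box (rdual X) (F X)) (box I W)).
    by move=> X Y f; rewrite !comp0m.
  have [s [_ sU]] := iotaU _ _ zeroD.
  rewrite -(sU 0) => [|X]; last by rewrite comp0m.
  apply/esym/sU => X; rewrite -mcompA -betaN mcompA -bmor_comp comp1m betaE comp_sumr.
  apply: big1 => a _; rewrite -bmor_comp -mcompA -(transposeK (e a)) jF.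
  by rewrite (mcompA t) tj comp0m bmor0r.
(* The transposes of the evaluations [Hom(P, rdual X) . F X -> F Q], which on the component at [p]
   are [F] of the map [X -> Q] corresponding to [p]. *)
pose kappa X : mor (box (rdual X) (F X)) (box I (F Q)) :=
  \sum_a bmor box (E a) (fmor F (transpose (e a))).
have kappaD : dinatural kappa.
  move=> X Y f; rewrite !comp_suml.
  under eq_bigr => a _ do
    rewrite -bmor_comp compm1 (dual_expand (_ \oc rdual_mor f)) bmor_suml.
  rewrite exchange_big; apply: eq_bigr => b _ /=.
  rewrite -bmor_comp compm1 -fmor_comp.
  have -> : transpose (e b) \oc f = \sum_a c a (rdual_mor f \oc e b) *: transpose (e a).
    rewrite -(basis_linear_sum _ (ecB _) (@transpose_lin X)).
    by rewrite -{2}(transposeK (e b)) mcompA -rdual_mor_comp transposeE.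
  rewrite fmor_sum bmor_sumr; apply: eq_bigr => a _.
  by rewrite -mcompA tauE bmorZl fmorZ bmorZr.
have [h [hE _]] := iotaU _ _ kappaD.
have [] : exists g, g \oc j = idm (F Q).
  exists (alpha _ \oc fmor Phi h).
  rewrite /j mcompA -(mcompA (alpha _)) -fmor_comp mcompA hE /kappa comp_suml fmor_sum.
  rewrite comp_sumr comp_suml.
  under eq_bigr => a _ do
    rewrite -bmor_comp compm1 -mcompA uN compm1 mcompA alphau tauE compZl comp1m -fmorZ.
  rewrite -fmor_sum -(basis_linear_sum _ (ecB _) (@transpose_lin Q)).
  by rewrite -[r in transpose r]comp1m -rdual_mor_id transposeE fmor_id.
move=> g gj; exists j, g; split=> //.
by apply: jE; rewrite -mcompA gj compm1 comp1m.
Qed.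

End CoendCopower.

(** * Projectives and simples of the Deligne product *)

Section CokernelFunctor.
Context {k : fieldType} {D : lincat k} (DA : abelian_cat D).
Context {G : functor D D} (GR : right_exact G) {eps : forall Z, mor (G Z) Z}.
Hypothesis (epsN : forall Z Z' (f : mor Z Z'), f \oc eps Z = eps Z' \oc fmor G f).

(** Cokernels commute with cokernels, whence right exactness; the objects are chosen arbitrarily,
    and functoriality is forced because each [q Z] is epi. *)
Lemma cokernel_functor : exists (Q : functor D D) (q : forall Z, mor Z (Q Z)),
  [/\ right_exact Q, forall Z, is_cokernel (eps Z) (q Z)
    & forall Z Z' (f : mor Z Z'), fmor Q f \oc q Z = q Z' \oc f].
Proof.
pose Q Z := sval (cid (has_cokernel DA (eps Z))).
pose q Z : mor Z (Q Z) := sval (cid (svalP (cid (has_cokernel DA (eps Z))))).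
have qC Z : is_cokernel (eps Z) (q Z) :=
  svalP (cid (svalP (cid (has_cokernel DA (eps Z))))).
have qE Z := cokernel_epi (qC Z).
have ex_mor Z Z' (f : mor Z Z') : exists h, h \oc q Z = q Z' \oc f.
  by apply: cokernel_factor (qC Z) _; rewrite -mcompA epsN mcompA (qC Z').1 comp0m.
pose Qm Z Z' (f : mor Z Z') := sval (cid (ex_mor Z Z' f)).
have Qq Z Z' (f : mor Z Z') : Qm Z Z' f \oc q Z = q Z' \oc f := svalP (cid (ex_mor Z Z' f)).
have Qm_id Z : Qm Z Z (idm Z) = idm (Q Z) by apply: qE; rewrite Qq comp1m compm1.
have Qm_comp X Y Z (g : mor Y Z) (f : mor X Y) : Qm X Z (g \oc f) = Qm Y Z g \oc Qm X Y f.
  by apply: qE; rewrite -mcompA !Qq (mcompA (Qm _ _ _)) Qq mcompA.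
have Qm_lin X Y : linear (@Qm X Y).
  by move=> a f g; apply: qE; rewrite compDl compZl !Qq compDr compZr.
exists (Functor Qm_id Qm_comp Qm_lin), q; split=> // X Y W f w wC; apply: cokernelI => /=.
- by rewrite -Qm_comp wC.1; apply: qE; rewrite Qq compm0 comp0m.
- apply: (epi_compl (f := q Y)); rewrite Qq.
  by apply: epi_comp => //; apply: cokernel_epi wC.
- move=> T t tf; have [|s sw] := cokernel_factor (g := t \oc q Y) wC.
    by rewrite -mcompA -Qq mcompA tf comp0m.
  have [|r rq] := cokernel_factor (g := s) (qC W).
    apply: (cokernel_epi (GR wC)); rewrite -mcompA -epsN mcompA sw -mcompA (qC Y).1.
    by rewrite compm0 comp0m.
  by exists r; apply: qE; rewrite -mcompA Qq mcompA rq sw.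
Qed.

End CokernelFunctor.

Lemma choose_bases (k : fieldType) (C : lincat k) (P : C) :
  (forall X, exists d, has_dim (mor P X) d) ->
  exists (n : C -> nat) (e : forall X, 'I_(n X) -> mor P X)
    (c : forall X, 'I_(n X) -> mor P X -> k), forall X, basis (e X) (c X).
Proof.
move=> hfd; pose bX X := svalP (cid (hfd X)).
exists (fun X => sval (cid (hfd X))), (fun X => sval (cid (bX X))).
exists (fun X => sval (cid (svalP (cid (bX X))))) => X.
exact: (svalP (cid (svalP (cid (bX X))))).
Qed.

Section BoxHom.
Context {k : fieldType} {C CC : lincat k} (CA : abelian_cat C).
Context {box : bifunctor C C CC} (hbox : deligne_product box).
Context {P : C} (PP : projective P) {n : C -> nat} {e : forall X, 'I_(n X) -> mor P X}.
Context {c : forall X, 'I_(n X) -> mor P X -> k}.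
Arguments e {X}. Arguments c {X}.
Hypothesis (ecB : forall X, basis (@e X) (@c X)).
Context {Phi : functor CC C} {u : forall X Y, mor P X -> mor Y (Phi (box X Y))}.
Context {pr : forall X Y, 'I_(n X) -> mor (Phi (box X Y)) Y}.
Arguments u {X Y}. Arguments pr {X Y}.
Hypothesis (PhiP : hom_copower (@e) (@c) (@u) (@pr)).

Lemma adjoint_has_dim Y Z d : has_dim (mor Y (Phi Z)) d -> has_dim (mor (box P Y) Z) d.
Proof.
have [eps [epsN _ eps1 eps2]] := copower_adjunction CA hbox ecB PhiP.
apply: (has_dim_bij (f := fun g => eps Z \oc bmor box (idm P) g)
  (g := fun f => fmor Phi f \oc copower_unit (u := @u) Y)).
- by move=> a g h; rewrite bmor_linr compDr compZr.
- move=> g; rewrite fmor_comp -mcompA (copower_unit_nat PhiP) mcompA eps2.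
  exact: comp1m.
- move=> f; rewrite -{2}(compm1 f) -eps1 mcompA epsN -!mcompA -bmor_comp.
  by rewrite compm1.
Qed.

(** A left adjoint preserves projectives as soon as its right adjoint preserves epimorphisms, and
    [Phi] does so by right exactness. *)
Lemma box_projective Y : projective Y -> projective (box P Y).
Proof.
have [CCA _ _] := hbox; have [PhiR _ _ _ _] := PhiP.
have [eps [epsN _ eps1 eps2]] := copower_adjunction CA hbox ecB PhiP.
move=> YP Z W f g fE.
have [h fh] := YP _ _ _ (fmor Phi g \oc copower_unit (u := @u) Y) (right_exact_epi CCA PhiR fE).
exists (eps Z \oc bmor box (idm P) h).
rewrite mcompA epsN -mcompA -bmor_comp compm1 fh -{1}(compm1 (idm P)) bmor_comp.
by rewrite mcompA -epsN -mcompA eps1 compm1.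
Qed.

Lemma copower_has_dim (b : bool) X Y W d : has_dim (mor P X) b -> has_dim (mor W Y) d ->
  has_dim (mor W (Phi (box X Y))) (b * d).
Proof.
have [_ uL _ upr pru] := PhiP; have [_ eS cE] := ecB X.
case: b => /= [/has_dim1P[x x0 xP]|/has_dim0P P0] Wd; last first.
  apply/has_dim0P => g; rewrite -(comp1m g) -upr big1 ?comp0m // => a _.
  by rewrite (P0 (e a)) (linear_zero (@uL X Y)) comp0m.
rewrite mul1n; apply: iso_has_dim Wd; exists (u x).
(* The basis of the line [mor P X] is indexed by ['I_(n X)], and [n X] is not literally [1]; the
   inverse of [u x] is therefore written as a sum over this index. *)
have [r er] := choice (fun a => xP (e a)).
have rx : \sum_a r a * c a x = 1.
  apply/eqP; rewrite -subr_eq0; apply: contraNT x0 => s0.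
  have : (\sum_a r a * c a x - 1) *: x = 0.
    rewrite scalerBl scale1r {3}(eS x) scaler_suml; apply/eqP; rewrite subr_eq0.
    by apply/eqP/eq_bigr => a _; rewrite (er a) scalerA mulrC.
  by move/eqP; rewrite scaler_eq0 (negPf s0).
exists (\sum_a r a *: pr a); split; rewrite ?comp_suml ?comp_sumr.
  under eq_bigr => a _ do rewrite compZl pru scalerA.
  by rewrite -scaler_suml rx scale1r.
rewrite -upr; apply: eq_bigr => a _.
by rewrite compZr {1}(er a) (linear_scale (@uL X Y)) compZl.
Qed.

(** The cokernel of the counit is a right exact functor vanishing on the [box X Y], hence
    zero by the uniqueness part of the universal property. *)
Lemma box_generates :
  (forall X Y (W : CC) (g : mor (box X Y) W),
     (forall x : mor P X, g \oc bmor box x (idm Y) = 0) -> g = 0) ->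
  forall (Z W : CC) (f : mor Z W), (forall Y (p : mor (box P Y) Z), f \oc p = 0) -> f = 0.
Proof.
move=> Pgen Z W f fp; have [CCA [_ boxr] _] := hbox; have [PhiR _ _ _ _] := PhiP.
have [eps [epsN epsu _ _]] := copower_adjunction CA hbox ecB PhiP.
have GR := right_exact_comp (boxr P) PhiR.
have [Q [q [QR qC qN]]] := cokernel_functor CCA GR epsN.
have Q0 Y : idm (Q Y) = 0.
  apply: (deligne_ext hbox CCA QR QR (s := fun Z => idm (Q Z)) (t := fun Z => 0)).
  - by move=> X X' g; rewrite comp1m compm1.
  - by move=> X X' g; rewrite comp0m compm0.
  move=> X X'; apply: (cokernel_epi (qC _)); rewrite comp1m comp0m.
  by apply: Pgen => x; rewrite -epsu mcompA (qC _).1 comp0m.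
(* The counit at [Z] is itself a map from some [box P Y], so the hypothesis on [f] applies to it. *)
have [h <-] := cokernel_factor (qC Z) (fp _ (eps Z)).
by rewrite -(comp1m (q Z)) Q0 comp0m compm0.
Qed.

End BoxHom.

(** * Generation by box products of projective covers *)

Section BoxSimples.
Context {k : fieldType} {C CC : lincat k} (CA : abelian_cat C).
Context {box : bifunctor C C CC} (hbox : deligne_product box).
Context {n : nat} {V P : 'I_n -> C}.
Hypothesis (hV : simple_representatives V).
Hypothesis (hP : forall i, projective_cover (P i) (V i)).
Hypothesis (hcs : forall X : C, exists s, composition_series X s).

(** Generation is proved for one projective and its functor [Phi]; an object having all the [P i] as
    retracts treats them simultaneously. *)
Lemma projective_sum p (R : 'I_p -> C) : (forall i, projective (R i)) ->
  exists G : C, projective G /\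
  forall i, exists (s : mor (R i) G) (r : mor G (R i)), r \oc s = idm _.
Proof.
elim: p R => [|p IH] R RP.
  have [[Z Z0] _ _ _ _] := CA; exists Z; split=> [X Y e f _|[]//].
  by exists 0; rewrite compm0 ((Z0 Y).1 f).
have [G [GP sG]] := IH (fun i => R (lift ord0 i)) (fun i => RP _).
have [_ /(_ (R ord0) G)[S [i1 [i2 [p1 [p2 [pi1 pi2 pi12 pi21 ip12]]]]]] _ _ _] := CA.
exists S; split=> [X Y e f eE|i].
  have [g1 eg1] := RP ord0 _ _ _ (f \oc i1) eE.
  have [g2 eg2] := GP _ _ _ (f \oc i2) eE.
  exists (g1 \oc p1 + g2 \oc p2).
  by rewrite compDr !mcompA eg1 eg2 -!mcompA -compDr ip12 compm1.
case: (unliftP ord0 i) => [j ->|->]; last by exists i1, p1.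
have [s [r rs]] := sG j; exists (i2 \oc s), (r \oc p2).
by rewrite -mcompA (mcompA p2) pi2 comp1m.
Qed.

(** Descend a composition series of [X]: either [g] is nonzero on the subobject, where induction
    applies, or it factors through [T] of the simple quotient. *)
Lemma simple_nonzero (D : lincat k) (T : functor C D) X s (Z : D) (g : mor (T X) Z) :
  right_exact T -> composition_series X s -> g <> 0 ->
  exists a (h : mor (T (V a)) Z), h <> 0.
Proof.
move=> TR Xs; elim: Xs Z g => {X s} [X X0|X Y S i q s [iK iC] sS _ IH] Z g g0.
  by case: g0; rewrite -(compm1 g) -fmor_id (is_zeroP X).1 // fmor0 compm0.
have [gi|/IH//] := pselect (g \oc fmor T i = 0).
have [h hq] := cokernel_factor (TR _ _ _ _ _ iC) gi.
have [_ _ /(_ _ sS)[a [f [f' [f'f ff']]]]] := hV.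
exists a, (h \oc fmor T f') => hf'; apply: g0.
by rewrite -hq -(compm1 h) -fmor_id -f'f fmor_comp mcompA hf' !comp0m.
Qed.

Lemma box_jointly_epi X Y (W : CC) (g : mor (box X Y) W) :
  (forall i j (p : mor (P i) X) (q : mor (P j) Y), g \oc bmor box p q = 0) -> g = 0.
Proof.
have [_ [boxl boxr] _] := hbox; have [s Xs] := hcs X; have [t Yt] := hcs Y => g0.
apply: (jointly_epi CA hV hP (g := g : mor (partial_l box Y X) W) (boxl Y) Xs) => i p /=.
apply: (jointly_epi CA hV hP (g := g \oc _ : mor (partial_r box (P i) Y) W) (boxr _) Yt).
by move=> j q /=; rewrite -mcompA -bmor_comp compm1 comp1m.
Qed.

Lemma box_cover_generates (Z W : CC) (f : mor Z W) :
  (forall X Y : C, exists d, has_dim (mor X Y) d) ->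
  (forall i j (p : mor (box (P i) (P j)) Z), f \oc p = 0) -> f = 0.
Proof.
move=> hfd fp; have [G [GP sG]] := projective_sum (fun i => (hP i).1).
have [n' [e [c ecB]]] := choose_bases (hfd G).
have [Phi [u [pr PhiP]]] := has_hom_copower CA hbox GP ecB.
apply: (box_generates CA hbox ecB PhiP) => [X Y W' g gx|Y p].
  apply: box_jointly_epi => i j p q; have [s [r rs]] := sG i.
  rewrite -(compm1 p) -rs mcompA -(comp1m q) !bmor_comp !mcompA.
  by rewrite gx !comp0m.
by apply: box_jointly_epi => i j x y; rewrite -mcompA fp.
Qed.

Lemma box_simple_nonzero (Z : CC) :
  (forall X Y : C, exists d, has_dim (mor X Y) d) -> ~ is_zero Z ->
  exists i j (f : mor (box (V i) (V j)) Z), f <> 0.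
Proof.
move=> hfd Z0; have [_ [boxl boxr] _] := hbox.
have [i [j [p p0]]] : exists i j (p : mor (box (P i) (P j)) Z), p <> 0.
  apply: contrapT => H; apply/Z0/is_zeroP/box_cover_generates => // i j p.
  by rewrite comp1m; apply: contrapT => p0; apply: H; exists i, j, p.
have [s Ps] := hcs (P i); have [t Pt] := hcs (P j).
have [a [g g0]] := simple_nonzero (T := partial_l box (P j)) (boxl _) Ps p0.
have [b [h h0]] := simple_nonzero (T := partial_r box (V a)) (boxr _) Pt g0.
by exists a, b, h.
Qed.

End BoxSimples.

(** * Categories of modules *)

Definition linear_of (k : fieldType) (U V : lmodType k) (f : U -> V) (fL : linear f) :
  {linear U -> V} := HB.pack f (GRing.isLinear.Build k U V *:%R f fL).

Section MakeModule.
Context {k : fieldType} {A : falgType k} (W : vectType k) (act : A -> W -> W).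
Hypothesis (actL : forall w, linear (act^~ w)) (actR : forall a, linear (act a)).
Hypothesis (act1 : forall w, act 1 w = w).
Hypothesis (actM : forall a b w, act (a * b) w = act a (act b w)).

Let act_lfun a : 'End(W) := linfun (linear_of (actR a)).

Let act_lfun_lin : linear act_lfun.
Proof.
move=> x a b; apply/lfunP => w.
by rewrite add_lfunE scale_lfunE !lfunE /= actL.
Qed.

Let act_lfun1 : linear_of act_lfun_lin 1 = \1%VF.
Proof. by apply/lfunP => w; rewrite id_lfunE lfunE /= act1. Qed.

Let act_lfunM a b :
  linear_of act_lfun_lin (a * b) = (linear_of act_lfun_lin a \o linear_of act_lfun_lin b)%VF.
Proof. by apply/lfunP => w; rewrite comp_lfunE !lfunE /= actM. Qed.

Definition module_of : fdmodule A := FdModule act_lfun1 act_lfunM.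

Lemma module_ofE a (w : W) : fdact module_of a w = act a w.
Proof. by rewrite lfunE. Qed.

End MakeModule.

Section Modules.
Context {k : fieldType} {A : falgType k}.
Implicit Types X Y Z K Q : modcat A.
Implicit Types V W : fdmodule A.

Lemma mhom_act V W (f : mhom V W) a v : f (fdact V a v) = fdact W a (f v).
Proof. by have /asboolP/(_ a)/lfunP/(_ v) := mhomP f; rewrite !comp_lfunE. Qed.

Lemma mhom_ext V W (f g : mhom V W) : (forall v, f v = g v) -> f = g.
Proof. by move=> fg; apply/val_inj/lfunP. Qed.

Lemma mhom_of V W (f : V -> W) : linear f -> (forall a v, f (fdact V a v) = fdact W a (f v)) ->
  exists g : mhom V W, forall v, g v = f v.
Proof.
move=> fL fA; have fP : linfun (linear_of fL) \in @intertwines k A V W.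
  by apply/asboolP => a; apply/lfunP => v; rewrite !comp_lfunE !lfunE /= fA.
by exists (MHom fP) => v; rewrite lfunE.
Qed.

Lemma mcompE X Y Z (g : mor Y Z) (f : mor X Y) (v : fdsort X) :
  mhom_val (g \oc f) v = mhom_val g (mhom_val f v).
Proof. exact: comp_lfunE. Qed.

Lemma idmE X (v : fdsort X) : mhom_val (idm X) v = v.
Proof. exact: id_lfunE. Qed.

Lemma mhom0E X Y (v : fdsort X) : mhom_val (0 : mor X Y) v = 0.
Proof. exact: zero_lfunE. Qed.

Lemma mhom_linE X Y a (f g : mor X Y) (v : fdsort X) :
  mhom_val (a *: f + g) v = a *: mhom_val f v + mhom_val g v.
Proof. by rewrite /= add_lfunE scale_lfunE. Qed.

Lemma mhom_sumE X Y I (r : seq I) (F : I -> mor X Y) (v : fdsort X) :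
  mhom_val (\sum_(i <- r) F i) v = \sum_(i <- r) mhom_val (F i) v.
Proof.
apply: (linear_bigsum (f := fun f : mor X Y => mhom_val f v)).
by move=> a f g; apply: mhom_linE.
Qed.

Lemma submodule V (P : V -> Prop) : P 0 -> (forall x u v, P u -> P v -> P (x *: u + v)) ->
  (forall a v, P v -> P (fdact V a v)) ->
  exists (K : modcat A) (i : @mor _ (modcat A) K V),
    injective (mhom_val i) /\ forall v, P v <-> exists u, mhom_val i u = v.
Proof.
move=> P0 PL PA; have [U UP] := vspace_of_closed P0 PL.
have val_act a (u : subvs_of U) : vsval (vsproj U (fdact V a (vsval u))) = fdact V a (vsval u).
  by apply/vsprojK/UP/PA/UP/subvsP.
pose act a (u : subvs_of U) := vsproj U (fdact V a (vsval u)).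
have actL u : linear (act^~ u).
  by move=> x a b; apply: subvs_inj; rewrite vsval_is_linear !val_act linearP /= add_lfunE scale_lfunE.
have actR a : linear (act a).
  by move=> x u v; apply: subvs_inj; rewrite !vsval_is_linear !val_act vsval_is_linear linearP.
have act1 u : act 1 u = u.
  by apply: subvs_inj; rewrite val_act fdact1 id_lfunE.
have actM a b u : act (a * b) u = act a (act b u).
  by apply: subvs_inj; rewrite !val_act fdactM comp_lfunE.
pose K := module_of actL actR act1 actM.
have iL : linear (vsval : K -> V) by move=> x u v; rewrite linearP.
have [i iE] := mhom_of iL (fun a v => etrans (congr1 vsval (module_ofE _ _ _ _ a v)) (val_act a v)).
exists K, i; split=> [u v|v]; first by rewrite !iE => /subvs_inj.
split=> [/UP vU|[u <-]]; last by rewrite iE; apply/UP/subvsP.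
by exists (vsproj U v); rewrite iE vsprojK.
Qed.

(** The quotient lives on the complement of the subspace [U], where [a] acts by acting in [V] and
    projecting back. Stability of [U] makes this multiplicative. *)
Lemma quotient_module V (P : V -> Prop) : P 0 ->
  (forall x u v, P u -> P v -> P (x *: u + v)) ->
  (forall a v, P v -> P (fdact V a v)) ->
  exists (Q : modcat A) (q : @mor _ (modcat A) V Q),
    (forall w, exists v, mhom_val q v = w) /\ forall v, P v <-> mhom_val q v = 0.
Proof.
move=> P0 PL PA; have [U UP] := vspace_of_closed P0 PL.
pose W := subvs_of (U^C)%VS.
have UC : (U^C :&: U = 0)%VS by rewrite capvC capv_compl.
pose q (v : V) : W := vsproj _ (daddv_pi (U^C) U v).
have qL : linear q by move=> x u v; rewrite /q !linearP.
have qs (w : W) : q (vsval w) = w.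
  by apply: subvs_inj; rewrite vsprojK ?memv_pi // daddv_pi_id ?subvsP.
have vs0 : vsval (0 : W) = 0 := linear_zero (@vsval_is_linear _ _ _).
have vq v : vsval (q v) = daddv_pi (U^C) U v by exact: (vsprojK (memv_pi _ _ _)).
have qU v : v \in U <-> q v = 0.
  have vE : daddv_pi (U^C) U v + daddv_pi U (U^C) v = v.
    by apply: daddv_pi_add => //; rewrite addvC addv_complf memvf.
  split=> [vU|/(congr1 vsval)]; last first.
    rewrite vq vs0 => v0.
    by rewrite -vE v0 add0r memv_pi.
  apply: subvs_inj; rewrite vq vs0.
  by apply: (addIr v); rewrite add0r -[RHS]vE (daddv_pi_id (capv_compl U) vU).
have qsq v : q (v - vsval (q v)) = 0 by rewrite (linear_sub qL) qs subrr.
have qact a v : q (fdact V a (vsval (q v))) = q (fdact V a v).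
  apply/esym/eqP; rewrite -subr_eq0 -(linear_sub qL) -linearB; apply/eqP/qU/UP/PA/UP/qU.
  exact: qsq.
pose act a (w : W) := q (fdact V a (vsval w)).
have actL u : linear (act^~ u).
  by move=> x a b; rewrite /act linearP add_lfunE scale_lfunE qL.
have actR a : linear (act a) by move=> x u v; rewrite /act !linearP qL.
have act1 u : act 1 u = u by rewrite /act fdact1 id_lfunE qs.
have actM a b u : act (a * b) u = act a (act b u).
  by rewrite /act fdactM comp_lfunE qact.
pose Q := module_of actL actR act1 actM.
have [r rE] : exists r : mhom V Q, forall v, r v = q v.
  by apply: (@mhom_of V Q q qL) => a v; rewrite module_ofE /act qact.
exists Q, r; split=> [w|v]; first by exists (vsval w); rewrite rE qs.
by rewrite rE; split=> [/UP/qU|/qU/UP].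
Qed.

Lemma mhom_lin X Y (f : mor X Y) : linear (mhom_val f).
Proof. by move=> x u v; rewrite linearP. Qed.

Lemma mhom_zero X Y (f : mor X Y) : mhom_val f 0 = 0.
Proof. exact: (linear_zero (mhom_lin f)). Qed.

Lemma mono_inj X Y (f : mor X Y) : is_mono f <-> injective (mhom_val f).
Proof.
split=> [fM|fI]; last first.
  by move=> W g h fgh; apply: mhom_ext => v; apply: fI; rewrite -!mcompE fgh.
apply: linear_inj_ker => [x u v|u fu]; first exact: mhom_lin.
have [|x u1 u2 f1 f2|a u1 f1|K [i [_ iP]]] := @submodule X (fun v => mhom_val f v = 0).
- exact: mhom_zero.
- by rewrite mhom_lin f1 f2 scaler0 addr0.
- by rewrite mhom_act f1 linear0.
have i0 : i = 0.
  apply/(monoP f).1 => //; apply: mhom_ext => v.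
  by rewrite mcompE mhom0E; apply/iP; exists v.
by have /iP[v <-] := fu; rewrite i0 mhom0E.
Qed.

Lemma epi_surj X Y (f : mor X Y) :
  is_epi f <-> forall w, exists v, mhom_val f v = w.
Proof.
split=> [fE w|fS]; last first.
  move=> W g h gfh; apply: mhom_ext => v; have [u <-] := fS v.
  by rewrite -!mcompE gfh.
have [|x _ _ [u1 <-] [u2 <-]|a _ [u <-]|Q [q [_ qP]]] :=
    @quotient_module Y (fun w => exists v, mhom_val f v = w).
- by exists 0; apply: mhom_zero.
- by exists (x *: u1 + u2); rewrite mhom_lin.
- by exists (fdact X a u); rewrite mhom_act.
have q0 : q = 0.
  apply/(epiP f).1 => //; apply: mhom_ext => v.
  by rewrite mcompE mhom0E; apply/qP; exists v.
by apply/qP; rewrite q0 mhom0E.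
Qed.

Lemma kernel_elements X Y K (f : mor X Y) (i : mor K X) : injective (mhom_val i) ->
  (forall v, mhom_val f v = 0 <-> exists u, mhom_val i u = v) -> is_kernel f i.
Proof.
move=> iI iP; apply: kernelI; [|exact/mono_inj|].
  by apply: mhom_ext => v; rewrite mcompE mhom0E; apply/iP; exists v.
move=> W g fg; have /choice[h hE] w : exists u, mhom_val i u = mhom_val g w.
  by apply/iP; rewrite -mcompE fg mhom0E.
have hL : linear h by move=> x u v; apply: iI; rewrite mhom_lin !hE mhom_lin.
have hA a v : h (fdact W a v) = fdact K a (h v) by apply: iI; rewrite mhom_act !hE mhom_act.
have [h' h'E] := mhom_of hL hA.
by exists h'; apply: mhom_ext => v; rewrite mcompE h'E hE.
Qed.

Lemma cokernel_elements X Y Q (f : mor X Y) (q : mor Y Q) :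
  (forall w, exists v, mhom_val q v = w) ->
  (forall v, mhom_val q v = 0 <-> exists u, mhom_val f u = v) -> is_cokernel f q.
Proof.
move=> qS qP; apply: cokernelI; [|exact/epi_surj|].
  by apply: mhom_ext => v; rewrite mcompE mhom0E; apply/qP; exists v.
move=> W g gf; have [s sE] := choice qS; pose h w := mhom_val g (s w).
have hq v : h (mhom_val q v) = mhom_val g v.
  apply/eqP; rewrite -subr_eq0 -(linear_sub (mhom_lin g)); apply/eqP.
  have [u <-] : exists u, mhom_val f u = s (mhom_val q v) - v.
    by apply/qP; rewrite (linear_sub (mhom_lin q)) sE subrr.
  by rewrite -mcompE gf mhom0E.
have hL : linear h.
  by move=> x u v; rewrite -(sE u) -(sE v) -(mhom_lin q) !hq (mhom_lin g).
have hA a v : h (fdact Q a v) = fdact W a (h v).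
  by rewrite -(sE v) -mhom_act !hq mhom_act.
have [h' h'E] := mhom_of hL hA.
by exists h'; apply: mhom_ext => v; rewrite mcompE h'E hq.
Qed.

Lemma has_kernel_elements X Y (f : mor X Y) : exists (K : modcat A) (i : mor K X),
  injective (mhom_val i) /\ forall v, mhom_val f v = 0 <-> exists u, mhom_val i u = v.
Proof.
apply: (@submodule X (fun v => mhom_val f v = 0)) => [|x u1 u2 f1 f2|a u1 f1].
- exact: mhom_zero.
- by rewrite mhom_lin f1 f2 scaler0 addr0.
- by rewrite mhom_act f1 linear0.
Qed.

Lemma has_cokernel_elements X Y (f : mor X Y) : exists (Q : modcat A) (q : mor Y Q),
  (forall w, exists v, mhom_val q v = w) /\
  forall v, mhom_val q v = 0 <-> exists u, mhom_val f u = v.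
Proof.
have [|x _ _ [u1 <-] [u2 <-]|a _ [u <-]|Q [q [qS qP]]] :=
    @quotient_module Y (fun w => exists v, mhom_val f v = w).
- by exists 0; apply: mhom_zero.
- by exists (x *: u1 + u2); rewrite mhom_lin.
- by exists (fdact X a u); rewrite mhom_act.
by exists Q, q; split=> // v; split=> /qP.
Qed.

Lemma zero_elements X : is_zero X <-> forall v : fdsort X, v = 0.
Proof.
split=> [/is_zeroP X0 v|X0]; first by rewrite -(idmE v) X0 mhom0E.
by apply/is_zeroP; apply: mhom_ext => v; rewrite (X0 v) !linear0.
Qed.

Lemma modcat_abelian : abelian_cat (modcat A).
Proof.
split.
- pose act (a : A) (v : 'rV[k]_0) := v.
  have actL v : linear (act^~ v) by move=> x a b; rewrite [LHS]thinmx0 [RHS]thinmx0.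
  have actR a : linear (act a) by [].
  exists (module_of actL actR (fun _ => erefl) (fun _ _ _ => erefl)).
  by apply/zero_elements => v; apply: thinmx0.
- move=> X Y; pose act a (v : fdsort X * fdsort Y) := (fdact X a v.1, fdact Y a v.2).
  have actL v : linear (act^~ v).
    by move=> x a b; rewrite /act !linearP !add_lfunE !scale_lfunE.
  have actR a : linear (act a) by move=> x u v; rewrite /act !linearP.
  have act1 v : act 1 v = v by rewrite /act !fdact1 !id_lfunE; case: v.
  have actM a b v : act (a * b) v = act a (act b v).
    by rewrite /act !fdactM !comp_lfunE.
  pose S : modcat A := module_of actL actR act1 actM.
  have [i1 i1E] : exists i : @mor _ (modcat A) X S, forall v, mhom_val i v = (v, 0).
    apply: (@mhom_of X S (fun v => (v, 0))) => [x u v|a v].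
      by apply: injective_projections => /=; rewrite ?scaler0 ?addr0.
    by rewrite module_ofE /act linear0.
  have [i2 i2E] : exists i : @mor _ (modcat A) Y S, forall v, mhom_val i v = (0, v).
    apply: (@mhom_of Y S (fun v => (0, v))) => [x u v|a v].
      by apply: injective_projections => /=; rewrite ?scaler0 ?addr0.
    by rewrite module_ofE /act linear0.
  have [p1 p1E] : exists p : @mor _ (modcat A) S X, forall v, mhom_val p v = v.1.
    by apply: (@mhom_of S X fst) => [x u v|a v] //; rewrite module_ofE.
  have [p2 p2E] : exists p : @mor _ (modcat A) S Y, forall v, mhom_val p v = v.2.
    by apply: (@mhom_of S Y snd) => [x u v|a v] //; rewrite module_ofE.
  exists S, i1, i2, p1, p2; split; apply: mhom_ext => v.
  + by rewrite mcompE i1E p1E idmE.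
  + by rewrite mcompE i2E p2E idmE.
  + by rewrite mcompE i2E p1E mhom0E.
  + by rewrite mcompE i1E p2E mhom0E.
  + rewrite idmE /= add_lfunE !comp_lfunE i1E i2E p1E p2E.
    by case: v => v1 v2; apply: injective_projections => /=; rewrite ?addr0 ?add0r.
- move=> X Y f; split.
    by have [K [i [iI iP]]] := has_kernel_elements f; exists K, i; apply: kernel_elements.
  have [Q [q [qS qP]]] := has_cokernel_elements f; exists Q, q.
  exact: cokernel_elements.
- move=> X Y f /mono_inj fI; have [Q [q [qS qP]]] := has_cokernel_elements f.
  by exists Q, q; apply: kernel_elements.
- move=> X Y f /epi_surj fS; have [K [i [iI iP]]] := has_kernel_elements f.
  by exists K, i; apply: cokernel_elements.
Qed.

Lemma modcat_has_dim X Y : exists d, has_dim (mor X Y) d.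
Proof.
apply: (@has_dim_sub k 'Hom(fdsort X, fdsort Y) _ (@mhom_val k A X Y)) => //.
exact: val_inj.
Qed.

Lemma modcat_additive_length :
  additive_length (fun X : modcat A => \dim {:fdsort X}).
Proof.
split=> [X Y Z f g [fK gC]|X X0]; last first.
  by apply/zero_elements/has_dim0P; rewrite -X0; apply: has_dim_vect.
have fI := (mono_inj f).1 (kernel_mono fK).
have gS := (epi_surj g).1 (cokernel_epi gC).
apply: has_dim_unique (has_dim_vect _) _.
apply: (has_dim_ext (f := mhom_val f) (g := mhom_val g)) (has_dim_vect _) (has_dim_vect _) => //.
- exact: mhom_lin.
- exact: mhom_lin.
move=> v; split=> [gv|[u <-]]; last by rewrite -mcompE fK.1 mhom0E.
have [K [i [iI iP]]] := has_kernel_elements g.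
have [h fh] := kernel_factor fK (kernel_elements iI iP).1.
by have /iP[u <-] := gv; exists (mhom_val h u); rewrite -mcompE fh.
Qed.

End Modules.

(** * The Nakayama functor on projective modules *)

Section ModuleNakayama.
Context {k : fieldType} {A : falgType k}.
Implicit Types X Y Z : modcat A.

Lemma fdact_add (V : fdmodule A) x a b (v : V) :
  fdact V (x *: a + b) v = x *: fdact V a v + fdact V b v.
Proof. by rewrite linearP add_lfunE scale_lfunE. Qed.

Lemma fdact_mul (V : fdmodule A) a b (v : V) : fdact V (a * b) v = fdact V a (fdact V b v).
Proof. by rewrite fdactM comp_lfunE. Qed.

Lemma fdact_lin (V : fdmodule A) a : linear (fdact V a).
Proof. by move=> x u v; rewrite linearP. Qed.

Let regular_actL (w : A) : linear (fun a : A => a * w).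
Proof. by move=> x a b; rewrite mulrDl scalerAl. Qed.
Let regular_actR (a : A) : linear (fun w : A => a * w).
Proof. by move=> x u v; rewrite mulrDr scalerAr. Qed.

Definition regular_module : modcat A :=
  module_of regular_actL regular_actR (@mul1r A) (fun a b w => esym (mulrA a b w)).

Lemma regular_act a (w : fdsort regular_module) : fdact regular_module a w = a * (w : A).
Proof. exact: module_ofE. Qed.

(** The dual basis lemma: the free module on a [k]-basis [s] of [P] maps onto [P], and the [h a] are
    the components of a splitting. *)
Lemma projective_dual_basis (P : modcat A) : projective P ->
  exists N (s : 'I_N -> fdsort P) (h : 'I_N -> mor P regular_module),
  forall p, p = \sum_a fdact P (mhom_val (h a) p : A) (s a).
Proof.
move=> PP; pose N := \dim {:fdsort P}.
pose act (a : A) (f : {ffun 'I_N -> A}) : {ffun 'I_N -> A} := [ffun i => a * f i].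
have actL f : linear (act^~ f).
  by move=> x a b; apply/ffunP => i; rewrite !ffunE mulrDl scalerAl.
have actR a : linear (act a).
  by move=> x f g; apply/ffunP => i; rewrite !ffunE mulrDr scalerAr.
have act1 f : act 1 f = f by apply/ffunP => i; rewrite ffunE mul1r.
have actM a b f : act (a * b) f = act a (act b f).
  by apply/ffunP => i; rewrite !ffunE mulrA.
pose Free : modcat A := module_of actL actR act1 actM.
have [s [cs [_ sS _]]] := has_dim_vect (fdsort P).
pose sum_s (f : {ffun 'I_N -> A}) := \sum_a fdact P (f a) (s a).
have sumL : linear sum_s.
  move=> x f g; rewrite /sum_s scaler_sumr -big_split; apply: eq_bigr => a _ /=.
  by rewrite !ffunE fdact_add.
have [phi phiE] : exists phi : @mor _ (modcat A) Free P, forall f, mhom_val phi f = sum_s f.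
  apply: (@mhom_of _ _ Free P sum_s sumL) => a f.
  rewrite module_ofE /sum_s (linear_bigsum (@fdact_lin P a)).
  by apply: eq_bigr => b _; rewrite ffunE fdact_mul.
have phiS : is_epi phi.
  apply/epi_surj => p; exists [ffun a => cs a p *: 1].
  rewrite phiE /sum_s {2}(sS p); apply: eq_bigr => a _.
  by rewrite ffunE linearZ /= scale_lfunE fdact1 id_lfunE.
have [g phig] := PP _ _ phi (idm P) phiS.
have /choice[h hE] a : exists h : mor P regular_module,
    forall p, mhom_val h p = (mhom_val g p : {ffun 'I_N -> A}) a.
  apply: (@mhom_of _ _ P regular_module) => [x p q|b p].
    by rewrite mhom_lin !ffunE.
  by rewrite mhom_act module_ofE ffunE regular_act.
exists N, s, h => p; rewrite -{1}(idmE p) -phig mcompE phiE.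
by apply: eq_bigr => a _; rewrite hE.
Qed.

(** The object is the dual of [Hom_A(P, A)], with [A] acting through right multiplication on the
    target [A]. The dual basis writes each [p : P -> X] as a sum of composites [P -> A -> X], so a
    form on [Hom(P, X)] is known from its values on such composites. *)
Lemma modcat_nakayama (P : modcat A) : projective P ->
  exists (I : modcat A) (tau : mor P I -> k), nakayama tau.
Proof.
move=> PP; have [N [s [h hs]]] := projective_dual_basis PP.
have [n [e [c ecB]]] := modcat_has_dim P regular_module.
have [cL eS cE] := ecB.
have /choice[rm rmE] (a : A) : exists r : @mor _ (modcat A) regular_module regular_module,
    forall x, mhom_val r x = (x : A) * a.
  apply: (@mhom_of _ _ regular_module regular_module (fun x : A => x * a)) => [|b x].
    exact: regular_actL.
  by rewrite !regular_act mulrA.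
have rm_lin x a b : rm (x *: a + b) = x *: rm a + rm b.
  apply: mhom_ext => v; rewrite mhom_linE !rmE mulrDr.
  by rewrite scalerAr.
(* Row vectors stand for linear forms on [Hom_A(P, A)], through their values on the basis [e]. *)
pose ev (nu : 'rV[k]_n) (g : mor P regular_module) := \sum_b c b g * nu 0 b.
have evL nu : linear (ev nu : _ -> k^o).
  move=> x f g; rewrite /ev scaler_sumr -big_split; apply: eq_bigr => b _ /=.
  by rewrite cL mulrDl -mulrA.
have evR g : linear (ev^~ g : _ -> k^o).
  move=> x nu nu'; rewrite /ev scaler_sumr -big_split; apply: eq_bigr => b _ /=.
  by rewrite !mxE mulrDr mulrCA.
have eve nu b : ev nu (e b) = nu 0 b.
  rewrite /ev (bigD1 b) //= cE eqxx mul1r big1 ?addr0 // => b' /negPf nb.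
  by rewrite cE nb mul0r.
have ev_row (f : mor P regular_module -> k) g : linear (f : _ -> k^o) ->
    ev (\row_b f (e b)) g = f g.
  move=> fL; rewrite (basis_linear_sum g ecB fL).
  by apply: eq_bigr => b _; rewrite mxE.
pose act (a : A) nu := \row_b ev nu (rm a \oc e b).
have rmL nu a : linear (fun g => ev nu (rm a \oc g) : k^o).
  by move=> x f g; rewrite comp_linr evL.
have ev_act a nu g : ev (act a nu) g = ev nu (rm a \oc g).
  exact: (ev_row (fun g => ev nu (rm a \oc g))).
have actL nu : linear (act^~ nu).
  by move=> x a b; apply/rowP => i; rewrite !mxE rm_lin comp_linl evL.
have actR a : linear (act a).
  by move=> x u v; apply/rowP => i; rewrite !mxE evR.
have act1 nu : act 1 nu = nu.
  apply/rowP => i; rewrite mxE -eve; congr (ev _ _).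
  by apply: mhom_ext => p; rewrite mcompE rmE mulr1.
have actM a b nu : act (a * b) nu = act a (act b nu).
  apply/rowP => i; rewrite !mxE ev_act; congr (ev _ _).
  by apply: mhom_ext => p; rewrite !mcompE !rmE mulrA.
pose I : modcat A := module_of actL actR act1 actM.
(* The trace of [g]: for [P] finitely generated projective, a map [P -> I] is an element of the
   tensor product of [Hom_A(P, A)] and [I], here the sum of the [h a] with [g (s a)], which is then
   contracted by evaluation. *)
pose tau (g : mor P I) := \sum_a ev (mhom_val g (s a)) (h a).
have evI (nu nu' : fdsort I) : (forall g, ev nu g = ev nu' g) -> nu = nu'.
  by move=> ee; apply/rowP => i; rewrite -!eve.
exists I, tau; split=> [x f g|X lam lamL].
  rewrite /tau scaler_sumr -big_split; apply: eq_bigr => a _.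
  by rewrite mhom_linE evR.
have /choice[r rE] (x : fdsort X) : exists r : @mor _ (modcat A) regular_module X,
    forall a, mhom_val r a = fdact X (a : A) x.
  apply: (@mhom_of _ _ regular_module X (fun a : A => fdact X a x)) => [y a b|a b].
    exact: fdact_add.
  by rewrite regular_act fdact_mul.
have tau_r (t : mor X I) x g : tau (t \oc (r x \oc g)) = ev (mhom_val t x) g.
  have gE : g = \sum_a rm (mhom_val g (s a)) \oc h a.
    apply: mhom_ext => p; rewrite {1}(hs p) (linear_bigsum (mhom_lin g)).
    rewrite mhom_sumE; apply: eq_bigr => a _.
    by rewrite mcompE rmE mhom_act regular_act.
  rewrite {2}gE (linear_bigsum (evL _)) /tau; apply: eq_bigr => a _.
  by rewrite -ev_act !mcompE rE mhom_act module_ofE.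
have lamrL x : linear (fun g => lam (r x \oc g) : k^o).
  by move=> y f g; rewrite comp_linr lamL.
(* The form on [Hom_A(P, A)] attached to [x] is [lam] composed with the map [r x] from [A] to [X]
   that sends [1] to [x]. *)
pose t (x : fdsort X) : fdsort I := \row_b lam (r x \oc e b).
have evt x g : ev (t x) g = lam (r x \oc g).
  exact: (ev_row (fun g => lam (r x \oc g))).
have tL : linear t.
  move=> y u v; apply/rowP => i; rewrite !mxE -lamL -comp_linl; congr (lam (_ \oc _)).
  by apply: mhom_ext => a; rewrite mhom_linE !rE fdact_lin.
have tA a x : t (fdact X a x) = fdact I a (t x).
  apply: evI => g; rewrite module_ofE ev_act !evt Defs.compA; congr (lam (_ \oc _)).
  by apply: mhom_ext => b; rewrite mcompE !rE rmE fdact_mul.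
have [t' t'E] := mhom_of tL tA.
exists t'; split=> [p|t2 t2E].
  have pE : p = \sum_a r (mhom_val p (s a)) \oc h a.
    apply: mhom_ext => y; rewrite {1}(hs y) (linear_bigsum (mhom_lin p)).
    by rewrite mhom_sumE; apply: eq_bigr => a _; rewrite mcompE rE mhom_act.
  rewrite {2}pE (linear_bigsum lamL) /tau; apply: eq_bigr => a _.
  by rewrite mcompE t'E evt.
apply: mhom_ext => x; apply: evI => g.
by rewrite t'E evt -tau_r t2E.
Qed.

End ModuleNakayama.

(** * Transport along an equivalence *)

Section FullyFaithful.
Context {k : fieldType} {C D : lincat k}.

Definition faithful (F : functor C D) := forall X Y (f g : mor X Y), fmor F f = fmor F g -> f = g.

Definition full (F : functor C D) :=
  forall X Y (g : mor (F X) (F Y)), exists f : mor X Y, fmor F f = g.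

Definition essentially_surjective (F : functor C D) := forall Z, exists X, iso (F X) Z.

Lemma retract_faithful (F : functor C D) (G : functor D C) :
  nat_iso (comp_functor G F) (id_functor C) -> faithful F.
Proof.
move=> [al [alN alI]] X Y f g Ffg; apply: (iso_epi (alI X)).
by have /= -> := alN _ _ f; rewrite Ffg -(alN _ _ g).
Qed.

End FullyFaithful.

Lemma equivalent_functor (k : fieldType) (C D : lincat k) : equivalent C D ->
  exists F : functor C D, [/\ faithful F, full F & essentially_surjective F].
Proof.
move=> [F [G [GF FG]]]; exists F; split; first exact: retract_faithful GF.
  have GI := retract_faithful FG; have [al [alN alI]] := GF.
  move=> X Y g; have [b [ba ab]] := alI X.
  (* Conjugating [G g] by [al] gives a map with the same image under [G F] as [G g]; faithfulness of
     [G] turns this into an equality with [g]. *)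
  exists (al Y \oc fmor G g \oc b : mor X Y); apply: GI.
  apply: (iso_mono (alI Y)); have /= <- := alN _ _ (al Y \oc fmor G g \oc b : mor X Y).
  by rewrite -mcompA ba compm1.
by move=> Z; have [be [_ beI]] := FG; exists (G Z), (be Z); apply: beI.
Qed.

Section Transport.
Context {k : fieldType} {C D : lincat k} {F : functor C D}.
Hypothesis (FI : faithful F) (FS : full F) (FE : essentially_surjective F).
Implicit Types X Y Z K Q : C.

Lemma faithful_eq0 X Y (f : mor X Y) : fmor F f = 0 -> f = 0.
Proof. by move=> f0; apply: FI; rewrite fmor0. Qed.

Lemma ff_epi X Y (f : mor X Y) : is_epi f <-> is_epi (fmor F f).
Proof.
split=> [fE|fE]; apply/epiP => W g gf.
  have [Z [h hI]] := FE W; have [h' [h'h hh']] := hI.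
  have [g' g'E] := FS (h' \oc g).
  have /(epiP f).1 : g' \oc f = 0.
    by apply: faithful_eq0; rewrite fmor_comp g'E -mcompA gf compm0.
  move=> /(_ fE) g'0; rewrite -(comp1m g) -hh' -mcompA -g'E g'0.
  by rewrite fmor0 compm0.
apply: faithful_eq0; apply: ((epiP _).1 fE).
by rewrite -fmor_comp gf fmor0.
Qed.

Lemma ff_mono X Y (f : mor X Y) : is_mono f <-> is_mono (fmor F f).
Proof.
split=> [fE|fE]; apply/monoP => W g fg.
  have [Z [h hI]] := FE W; have [h' [h'h hh']] := hI.
  have [g' g'E] := FS (g \oc h).
  have g'0 : g' = 0.
    apply: ((monoP f).1 fE).
    by apply: faithful_eq0; rewrite fmor_comp g'E mcompA fg comp0m.
  by rewrite -(compm1 g) -hh' mcompA -g'E g'0 fmor0 comp0m.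
apply: faithful_eq0; apply: ((monoP _).1 fE).
by rewrite -fmor_comp fg fmor0.
Qed.

Lemma ff_cokernel X Y Q (f : mor X Y) (q : mor Y Q) :
  is_cokernel f q <-> is_cokernel (fmor F f) (fmor F q).
Proof.
split=> qC; apply: cokernelI.
- by rewrite -fmor_comp qC.1 fmor0.
- exact/ff_epi/cokernel_epi/qC.
- move=> W g gf; have [Z [h [h' [h'h hh']]]] := FE W; have [g' g'E] := FS (h' \oc g).
  have [|t tq] := cokernel_factor (g := g') qC.
    by apply: faithful_eq0; rewrite fmor_comp g'E -mcompA gf compm0.
  exists (h \oc fmor F t).
  by rewrite -mcompA -fmor_comp tq g'E mcompA hh' comp1m.
- by apply: faithful_eq0; rewrite fmor_comp qC.1.
- exact/ff_epi/cokernel_epi/qC.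
- move=> W g gf; have [|t tq] := cokernel_factor (g := fmor F g) qC.
    by rewrite -fmor_comp gf fmor0.
  by have [t' t'E] := FS t; exists t'; apply: FI; rewrite fmor_comp t'E.
Qed.

Lemma ff_kernel X Y K (f : mor X Y) (i : mor K X) :
  is_kernel f i <-> is_kernel (fmor F f) (fmor F i).
Proof.
split=> iK; apply: kernelI.
- by rewrite -fmor_comp iK.1 fmor0.
- exact/ff_mono/kernel_mono/iK.
- move=> W g fg; have [Z [h [h' [h'h hh']]]] := FE W; have [g' g'E] := FS (g \oc h).
  have [|t tq] := kernel_factor (g := g') iK.
    by apply: faithful_eq0; rewrite fmor_comp g'E mcompA fg comp0m.
  exists (fmor F t \oc h').
  by rewrite mcompA -fmor_comp tq g'E -mcompA hh' compm1.
- by apply: faithful_eq0; rewrite fmor_comp iK.1.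
- exact/ff_mono/kernel_mono/iK.
- move=> W g fg; have [|t tq] := kernel_factor (g := fmor F g) iK.
    by rewrite -fmor_comp fg fmor0.
  by have [t' t'E] := FS t; exists t'; apply: FI; rewrite fmor_comp t'E.
Qed.

Lemma ff_zero X : is_zero X <-> is_zero (F X).
Proof.
split=> /is_zeroP X0; apply/is_zeroP; first by rewrite -fmor_id X0 fmor0.
by apply: faithful_eq0; rewrite fmor_id.
Qed.

Lemma ff_abelian : abelian_cat D -> abelian_cat C.
Proof.
move=> DA.
(* Kernels and cokernels found in [D] need not lie in the image of [F]; these two facts replace
   their objects by isomorphic ones coming from [C]. *)
have FSl X (Z : D) (g : mor Z (F X)) : exists Y (h : mor Y X) (t : mor (F Y) Z),
    is_iso t /\ fmor F h = g \oc t.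
  have [Y [t tI]] := FE Z; have [h hE] := FS (g \oc t).
  by exists Y, h, t.
have FSr X (Z : D) (g : mor (F X) Z) : exists Y (h : mor X Y) (t : mor Z (F Y)),
    is_iso t /\ fmor F h = t \oc g.
  have [Y [t [t' [t't tt']]]] := FE Z; have [h hE] := FS (t' \oc g).
  by exists Y, h, t'; split=> //; exists t.
split.
- have [[Z /is_zeroP Z0] _ _ _ _] := DA; have [X [h [h' [h'h hh']]]] := FE Z; exists X.
  by apply/ff_zero/is_zeroP; rewrite -h'h -(comp1m h) Z0 comp0m compm0.
- move=> X Y; have [_ /(_ (F X) (F Y))[S [i1 [i2 [p1 [p2 H]]]]] _ _ _] := DA.
  have [pi1 pi2 pi12 pi21 ip] := H.
  have [T [h [h' [h'h hh']]]] := FE S.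
  have [j1 j1E] := FS (h' \oc i1); have [j2 j2E] := FS (h' \oc i2).
  have [q1 q1E] := FS (p1 \oc h); have [q2 q2E] := FS (p2 \oc h).
  have pj (A B : D) (p : mor S A) (i : mor B S) : p \oc h \oc (h' \oc i) = p \oc i.
    by rewrite mcompA -(mcompA p) hh' compm1.
  exists T, j1, j2, q1, q2; split; apply: FI.
  + by rewrite fmor_comp q1E j1E pj pi1 fmor_id.
  + by rewrite fmor_comp q2E j2E pj pi2 fmor_id.
  + by rewrite fmor_comp q1E j2E pj pi12 fmor0.
  + by rewrite fmor_comp q2E j1E pj pi21 fmor0.
  + have FD : linear (@fmor _ _ _ F T T) := @fmor_lin _ _ _ F T T.
    rewrite (linear_add FD) !fmor_comp q1E q2E j1E j2E -!(mcompA h') !(mcompA _ _ h).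
    by rewrite -compDl -compDr ip compm1 h'h fmor_id.
- move=> X Y f; split.
    have [K [i iK]] := has_kernel DA (fmor F f).
    have [L [j [t [tI jE]]]] := FSl _ _ i; exists L, j; apply/ff_kernel; rewrite jE.
    have [t' [t't tt']] := tI.
    apply: kernelI => [||W g fg].
    + by rewrite mcompA iK.1 comp0m.
    + move=> W a b; rewrite -!mcompA => /(kernel_mono iK).
      exact: (iso_mono tI).
    + have [s <-] := kernel_factor iK fg; exists (t' \oc s).
      by rewrite mcompA -(mcompA i) tt' compm1.
  have [K [i iK]] := has_cokernel DA (fmor F f).
  have [L [j [t [tI jE]]]] := FSr _ _ i; exists L, j; apply/ff_cokernel; rewrite jE.
  have [t' [t't tt']] := tI.
  apply: cokernelI => [||W g fg].
  + by rewrite -mcompA iK.1 compm0.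
  + by apply: epi_comp; [apply: iso_epi|apply: cokernel_epi iK].
  + have [s <-] := cokernel_factor iK fg; exists (s \oc t').
    by rewrite mcompA -(mcompA s) t't compm1.
- move=> X Y f /ff_mono fM; have [Z [g [gK _]]] := mono_short_exact DA fM.
  have [L [j [t [tI jE]]]] := FSr _ _ g; exists L, j; apply/ff_kernel; rewrite jE.
  apply: kernelI => // [|W s]; first by rewrite -mcompA gK.1 compm0.
  rewrite -mcompA => ts; apply: (kernel_factor gK).
  exact: ((monoP t).1 (iso_mono tI)).
- move=> X Y f /ff_epi fE; have [Z [g [_ gC]]] := epi_short_exact DA fE.
  have [L [j [t [tI jE]]]] := FSl _ _ g; exists L, j; apply/ff_cokernel; rewrite jE.
  apply: cokernelI => // [|W s]; first by rewrite mcompA gC.1 comp0m.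
  rewrite mcompA => ts; apply: (cokernel_factor gC).
  exact: ((epiP t).1 (iso_epi tI)).
Qed.

Lemma ff_has_dim X Y d : has_dim (mor (F X) (F Y)) d -> has_dim (mor X Y) d.
Proof.
have [g gE] := choice (@FS X Y).
apply: (has_dim_bij (f := g) (g := fmor F)) => [a u v|f|f]; last 2 first.
- exact: gE.
- by apply: FI; rewrite gE.
by apply: FI; rewrite fmor_lin !gE.
Qed.

Lemma ff_additive_length d : additive_length d -> additive_length (fun X => d (F X)).
Proof.
move=> [dE d0]; split=> [X Y Z f g [fK gC]|X /d0 /ff_zero //].
apply: dE; split; [exact/ff_kernel/fK|exact/ff_cokernel/gC].
Qed.

Lemma ff_projective P : projective P -> projective (F P).
Proof.
move=> PP Y Z e f eE.
have [Y0 [y [y' [y'y yy']]]] := FE Y; have [Z0 [z zI]] := FE Z.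
have [z' [z'z zz']] := zI.
have [e0 e0E] := FS (z' \oc e \oc y); have [f0 f0E] := FS (z' \oc f).
have [|g gE] := PP _ _ e0 f0.
  apply/ff_epi; rewrite e0E; apply: epi_comp; last by apply: iso_epi; exists y'.
  by apply: epi_comp => //; apply: iso_epi; exists z.
exists (y \oc fmor F g); have z'M : is_mono z' by apply: iso_mono; exists z.
by apply: z'M; rewrite -f0E -gE fmor_comp e0E -!mcompA.
Qed.

Lemma ff_nakayama P (J : D) (tau : mor (F P) J -> k) : nakayama tau ->
  exists (I : C) (tau' : mor P I -> k), nakayama tau'.
Proof.
move=> [tauL tauU]; have [I [s [s' [s's ss']]]] := FE J.
exists I, (fun t => tau (s \oc fmor F t)); split=> [a u v|X lam lamL].
  by rewrite fmor_lin comp_linr tauL.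
have [g gE] := choice (@FS P X).
have gF p : g (fmor F p) = p by apply: FI; rewrite gE.
have [|t [tE tU]] := tauU (F X) (fun p => lam (g p)).
  by move=> a u v; rewrite -lamL; congr lam; apply: FI; rewrite fmor_lin !gE.
have [r rE] := FS (s' \oc t).
exists r; split=> [p|r' r'E].
  by rewrite fmor_comp rE !mcompA ss' comp1m tE gF.
apply: FI; rewrite rE (tU (s \oc fmor F r')) => [|p].
  by rewrite mcompA s's comp1m.
by rewrite -(r'E (g p)) fmor_comp gE mcompA.
Qed.

End Transport.

(** * Categories equivalent to a module category *)

Section ModuleCategories.
Context {k : fieldType} {A : falgType k} {C : lincat k} (CA : equivalent C (modcat A)).

Lemma equivalent_abelian : abelian_cat C.
Proof.
by have [F [FI FS FE]] := equivalent_functor CA; exact: (ff_abelian FI FS FE modcat_abelian).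
Qed.

Lemma equivalent_has_dim (X Y : C) : exists d, has_dim (mor X Y) d.
Proof.
have [F [FI FS FE]] := equivalent_functor CA; have [d dP] := modcat_has_dim (F X) (F Y).
by exists d; exact: (ff_has_dim FI FS dP).
Qed.

Lemma equivalent_additive_length : exists d : C -> nat, additive_length d.
Proof.
have [F [FI FS FE]] := equivalent_functor CA.
by eexists; exact: (ff_additive_length FI FS FE modcat_additive_length).
Qed.

Lemma equivalent_nakayama (P : C) :
  projective P -> exists (I : C) (tau : mor P I -> k), nakayama tau.
Proof.
have [F [FI FS FE]] := equivalent_functor CA.
move=> /(ff_projective FI FS FE)/modcat_nakayama[J [tau tauP]].
exact: (ff_nakayama FI FS FE tauP).
Qed.

End ModuleCategories.

(** * The class of the coend in the Grothendieck group *)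

Theorem theorem4p11 (k : closedFieldType) (C : finTensorCat k)
    (m : nat) (V P : 'I_m.+1 -> C)
    (hV : simple_representatives V)
    (hP : forall i, projective_cover (P i) (V i))
    (CC : lincat k) (box : bifunctor C C CC) (hbox : deligne_product box)
    (F : functor C C) (hF : left_exact F)
    (E : CC) (iota : forall X : C, mor (box (rdual X) (F X)) E)
    (hE : is_coend iota) :
  Gr_coset (gen E) =
  Gr_coset (fun W => \sum_(i < m.+1) \sum_(j < m.+1)
              gen (box (V i) (V j)) W *+ mult (F (ldual (P i))) (V j)).
Proof.
have [A CeqA] := ftc_finite C; have CA := equivalent_abelian CeqA.
have hfd := equivalent_has_dim CeqA; have [d dL] := equivalent_additive_length CeqA.
have hcs := has_composition_series CA dL; have [CCA _ _] := hbox.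
have PP i := (hP i).1.
have schurV i f : exists a, f = a *: idm (V i).
  have [sV _ _] := hV; have [b hb] := hfd (V i) (V i).
  exact: schur CA (sV i) hb f.
have dimV i j : has_dim (mor (P i) (V j)) (i == j) := has_dim_cover CA hV hP schurV i j.
pose T := ('I_m.+1 * 'I_m.+1)%type.
pose BP (t : T) := box (P t.1) (P t.2); pose BV (t : T) := box (V t.1) (V t.2).
pose D (t : T) := mult (F (ldual (P t.1))) (V t.2).
rewrite (@Gr_coset_eq _ _ (gen E) (fun W => \sum_t gen (BV t) W *+ D t)); last first.
  apply: (Gr_decomposition (P := BP) CCA).
  (* [Phi] depends on the first index [i], so each verification builds one from [P i]; the resulting
     facts about [box (P i) (P j)] no longer mention it. *)
  - move=> [i j]; have [n [e [c ecB]]] := choose_bases (hfd (P i)).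
    have [Phi [u [pr PhiP]]] := has_hom_copower CA hbox (PP i) ecB.
    exact: (box_projective CA hbox ecB PhiP).
  - move=> [i j] [i' j']; have [n [e [c ecB]]] := choose_bases (hfd (P i)).
    have [Phi [u [pr PhiP]]] := has_hom_copower CA hbox (PP i) ecB.
    apply: (adjoint_has_dim CA hbox ecB PhiP); rewrite xpair_eqE -mulnb.
    exact: (copower_has_dim ecB PhiP).
  - move=> [i j] Z; have [n [e [c ecB]]] := choose_bases (hfd (P i)).
    have [Phi [u [pr PhiP]]] := has_hom_copower CA hbox (PP i) ecB.
    have [b Hb] := hfd (P j) (Phi Z); exists b.
    exact: (adjoint_has_dim CA hbox ecB PhiP).
  - move=> Z W f fp; apply: (box_cover_generates CA hbox hV hP hcs hfd) => i j.
    exact: (fp (i, j)).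
  - move=> Z /(box_simple_nonzero CA hbox hV hP hcs hfd)[i [j [f f0]]].
    by exists (i, j), f.
  move=> [i j]; have [n [e [c ecB]]] := choose_bases (hfd (P i)).
  have [Phi [u [pr PhiP]]] := has_hom_copower CA hbox (PP i) ecB.
  have [I [tau tauP]] := equivalent_nakayama CeqA (PP i).
  have [r rP] := rdual_ldual (P i).
  apply: (adjoint_has_dim CA hbox ecB PhiP).
  apply: iso_has_dim (coend_copower CA hbox ecB PhiP tauP rP hE) _.
  have [s Fs] := hcs (F (ldual (P i))).
  exact: (mult_has_dim CA hV hP schurV j Fs).
by congr Gr_coset; apply/funext => W; rewrite pair_bigA.
Qed.
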